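(* Let $P$ be a set of $n$ points drawn independently and uniformly at random from the unit square $[0,1]^2$, and let $k$ be an integer with $3\cdot 10^5 \le k \le n/(10^5 \ln n)$. Then there is an algorithm running in $O(n)$ time that, for all sufficiently large $n$, with probability at least $1-1/n$ outputs $k$ points of $P$ whose minimum pairwise Euclidean distance is at least $0.99\cdot \mathrm{OPT}$, where $\mathrm{OPT}$ is the maximum, over all $k$-subsets of $P$, of the minimum pairwise Euclidean distance within the subset.
   Context: This is an approximation guarantee for the $k$-dispersion problem: given a finite point set $P$ in the plane and a positive integer $k\le |P|$, select $k$ points of $P$ so that the minimum Euclidean distance between two distinct selected points is maximized. A $0.99$-approximation is a $k$-subset whose minimum pairwise distance is at least $0.99$ times the optimum. $\ln$ denotes the natural logarithm. *)

(* Defs.v *)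
From HB Require Import structures.
From mathcomp Require Import all_boot all_order all_algebra.
From mathcomp Require Import all_classical all_reals all_analysis.
Set Implicit Arguments. Unset Strict Implicit. Unset Printing Implicit Defensive.
Import Order.TTheory GRing.Theory Num.Theory.
Local Open Scope ring_scope.
Local Open Scope classical_set_scope.

Section Dispersion.
Variable R : realType.

Definition edist (p q : R * R) : R :=
  Num.sqrt ((p.1 - q.1) ^+ 2 + (p.2 - q.2) ^+ 2).

(* minimum pairwise distance of the points indexed by S (+oo if |S| < 2) *)
Definition mindist (n : nat) (pts : 'I_n -> R * R) (S : {set 'I_n}) : \bar R :=
  \big[Order.min/+oo%E]_(i in S) \big[Order.min/+oo%E]_(j in S | j != i)
     (edist (pts i) (pts j))%:E.

Definition dispersion_opt (n k : nat) (pts : 'I_n -> R * R) : \bar R :=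
  \big[Order.max/-oo%E]_(S : {set 'I_n} | #|S| == k) mindist pts S.
End Dispersion.

Inductive instr : Type :=
| ICst   (d : nat) (z : int)
| IAdd   (d a b : nat)
| ISub   (d a b : nat)
| IMul   (d a b : nat)
| IDiv   (d a b : nat)            (* m[d] := m[a] / m[b]  (x/0 = 0) *)
| IFloor (d a : nat)
| ILoad  (d a : nat)
| IStore (a s : nat)
| IJlt   (a b t : nat)
| IJmp   (t : nat)
| IHalt.

Section RealRAM.
Variable R : realType.

Definition state := (nat * (nat -> R))%type.

Definition upd (m : nat -> R) (d : nat) (v : R) : nat -> R :=
  fun i => if i == d then v else m i.

Definition addr (x : R) : nat := Num.truncn x.

(* one step; None when the machine has halted (IHalt or pc out of range) *)
Definition step (p : seq instr) (s : state) : option state :=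
  let: (pc, m) := s in
  match nth IHalt p pc with
  | ICst d z => Some (pc.+1, upd m d (z%:~R))
  | IAdd d a b => Some (pc.+1, upd m d (m a + m b))
  | ISub d a b => Some (pc.+1, upd m d (m a - m b))
  | IMul d a b => Some (pc.+1, upd m d (m a * m b))
  | IDiv d a b => Some (pc.+1, upd m d (m a / m b))
  | IFloor d a => Some (pc.+1, upd m d ((Num.floor (m a))%:~R))
  | ILoad d a => Some (pc.+1, upd m d (m (addr (m a))))
  | IStore a s => Some (pc.+1, upd m (addr (m a)) (m s))
  | IJlt a b t => Some (if m a < m b then t else pc.+1, m)
  | IJmp t => Some (t, m)
  | IHalt => None
  end.

Fixpoint run (p : seq instr) (fuel : nat) (s : state) : option state :=
  match step p s with
  | None => Some s
  | Some s' => if fuel is fuel'.+1 then run p fuel' s' else None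
  end.

(* Input encoding: m[0] = n, m[1] = k, m[2+2i] = x_i, m[3+2i] = y_i (i < n),
   all other cells 0; execution starts at pc = 0. *)
Definition init_mem (n k : nat) (pts : 'I_n -> R * R) : nat -> R :=
  fun a =>
    if a == 0%N then n%:R
    else if a == 1%N then k%:R
    else match @insub nat (fun i => (i < n)%N) 'I_n ((a - 2)./2) with
         | Some i => if odd a then (pts i).2 else (pts i).1
         | None => 0
         end.

Definition init_state (n k : nat) (pts : 'I_n -> R * R) : state :=
  (0%N, init_mem k pts).

Definition good_output (n k : nat) (pts : 'I_n -> R * R) (m : nat -> R) : Prop :=
  exists f : 'I_k -> 'I_n,
    injective f /\
    (forall j : 'I_k, m (nat_of_ord j) = (nat_of_ord (f j))%:R) /\
    ((99%:R / 100%:R : R)%:E * dispersion_opt k pts <= mindist pts [set f j | j in 'I_k])%E.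

Definition ram_solves (p : seq instr) (n k : nat) (pts : 'I_n -> R * R) : Prop :=
  exists fuel s', run p fuel (init_state k pts) = Some s' /\ good_output k pts s'.2.
End RealRAM.

Section Prob.
Context {R : realType} {d : measure_display} {T : measurableType d}.

Definition mutually_independent (I : finType) (P : probability T R)
    (F : I -> T -> R) : Prop :=
  (forall i, measurable_fun setT (F i)) /\
  forall B : I -> set R, (forall i, measurable (B i)) ->
    P (\bigcap_(i in [set: I]) (F i @^-1` B i)) = (\prod_(i : I) P (F i @^-1` B i))%E.

Definition uniform01 (P : probability T R) (X : T -> R) : Prop :=
  forall B : set R, measurable B ->
    P (X @^-1` B) = (@lebesgue_measure R) (B `&` `[0, 1]).
End Prob.

(* Main.v *)
(* The constants of the program need not be computed, only exist, and this replaces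
   the knowledge of the optimal packing density.  Write [packable m d] when the unit
   square holds [m] points at mutual distance at least [d], and put
   [shrink d = d / (1 + d)].  Shrinking such a configuration by [1 / (1 + d)] leaves a
   margin around it, so that repeating it over a [g] by [g] subdivision of the square
   gives [g ^ 2 * m] points at mutual distance at least [shrink d / g].  The numbers
   [sqrt m * shrink d] are bounded by pigeonhole; fix [(m, d)] almost attaining their
   supremum.  The supremum bounds the optimum for [k] from above, and tiling by the
   fixed configuration almost attains it as soon as [k] is large.  The finitely many
   remaining [k] are tiled once by an almost optimal configuration for [k] itself.

   The program carries these finitely many configurations as tables over a fine grid of
   the tile: an entry says which site, if any, the grid cell is close to.  Each input
   point is assigned to the slot (tile, site) it falls near, and the last point of each
   slot is output.  Independence and a union bound show that with probability at least
   [1 - 1 / n] every slot receives a point. *)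

Require Import Defs.
From HB Require Import structures.
From mathcomp Require Import all_boot all_order all_algebra.
From mathcomp Require Import all_classical all_reals all_analysis.
From mathcomp Require Import zify ring lra.
Set Implicit Arguments. Unset Strict Implicit. Unset Printing Implicit Defensive.
Import Order.TTheory GRing.Theory Num.Theory.
Local Open Scope ring_scope.
Local Open Scope classical_set_scope.

Local Notation edist := Defs.edist.

(** * The program and its execution *)

Section Ram.
Variable R : realType.
Implicit Types (p : seq instr) (m : nat -> R) (Q : state R -> Prop).

(* [reach p c s Q]: within [c] steps the execution from [s] visits a state satisfying [Q]. *)
Fixpoint reach p (c : nat) (s : state R) Q : Prop :=
  Q s \/ (if c is c'.+1 then exists2 s', step p s = Some s' & reach p c' s' Q
          else False).

Lemma reach_done p c s Q : Q s -> reach p c s Q.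
Proof. by case: c => [|c] Qs; left. Qed.

Lemma reach_step p c s s' Q :
  step p s = Some s' -> reach p c s' Q -> reach p c.+1 s Q.
Proof. by move=> st r; right; exists s'. Qed.

Lemma reach_le p c c' s Q : (c <= c')%N -> reach p c s Q -> reach p c' s Q.
Proof.
elim: c c' s => [|c IH] c' s le_cc'; first by case=> // ?; apply: reach_done.
case=> [?|[s' st r]]; first exact: reach_done.
by case: c' le_cc' => // c' le_cc'; apply: reach_step st _; apply: IH.
Qed.

Lemma reach_seq p c1 c2 s Q1 Q2 :
  reach p c1 s Q1 -> (forall s', Q1 s' -> reach p c2 s' Q2) ->
  reach p (c1 + c2) s Q2.
Proof.
elim: c1 s => [|c1 IH] s; first by case=> // Qs; apply.
case=> [Qs H|[s' st r] H]; first by apply: reach_le (H _ Qs); rewrite leq_addl.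
by rewrite addSn; apply: reach_step st _; apply: IH.
Qed.

Lemma reach_run p c s Q : reach p c s Q ->
  (forall s', Q s' -> step p s' = None) ->
  exists2 s', run p c s = Some s' & Q s'.
Proof.
elim: c s => [|c IH] s /=.
  by case=> // Qs H; exists s => //; rewrite (H _ Qs).
case=> [Qs H|[s' st r] H]; first by exists s => //; rewrite (H _ Qs).
by rewrite st; apply: IH.
Qed.

Lemma upd_same m d v : upd m d v d = v.
Proof. by rewrite /upd eqxx. Qed.

Lemma upd_other m d v a : (a != d) = true -> upd m d v a = m a.
Proof. by rewrite /upd => /negbTE->. Qed.

Lemma upd_low m d v a : (d < 32)%N -> (32 <= a)%N -> upd m d v a = m a.
Proof. by move=> ? ?; apply: upd_other; apply/negP => /eqP; lia. Qed.

Lemma addr_nat (a : nat) : addr (a%:R : R) = a.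
Proof. exact: natrK. Qed.

Section Rules.
Variables (p : seq instr) (c pc : nat) (m : nat -> R) (Q : state R -> Prop).

Lemma reach_cst d z : nth IHalt p pc = ICst d z ->
  reach p c (pc.+1, upd m d z%:~R) Q -> reach p c.+1 (pc, m) Q.
Proof. by move=> E; apply: reach_step; rewrite /= E. Qed.

Lemma reach_add d a b va vb : nth IHalt p pc = IAdd d a b ->
  m a = va -> m b = vb ->
  reach p c (pc.+1, upd m d (va + vb)) Q -> reach p c.+1 (pc, m) Q.
Proof. by move=> E <- <-; apply: reach_step; rewrite /= E. Qed.

Lemma reach_sub d a b va vb : nth IHalt p pc = ISub d a b ->
  m a = va -> m b = vb ->
  reach p c (pc.+1, upd m d (va - vb)) Q -> reach p c.+1 (pc, m) Q.
Proof. by move=> E <- <-; apply: reach_step; rewrite /= E. Qed.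

Lemma reach_mul d a b va vb : nth IHalt p pc = IMul d a b ->
  m a = va -> m b = vb ->
  reach p c (pc.+1, upd m d (va * vb)) Q -> reach p c.+1 (pc, m) Q.
Proof. by move=> E <- <-; apply: reach_step; rewrite /= E. Qed.

Lemma reach_floor d a va : nth IHalt p pc = IFloor d a -> m a = va ->
  reach p c (pc.+1, upd m d (Num.floor va)%:~R) Q -> reach p c.+1 (pc, m) Q.
Proof. by move=> E <-; apply: reach_step; rewrite /= E. Qed.

Lemma reach_load d a va v : nth IHalt p pc = ILoad d a -> m a = va ->
  m (addr va) = v ->
  reach p c (pc.+1, upd m d v) Q -> reach p c.+1 (pc, m) Q.
Proof. by move=> E <- <-; apply: reach_step; rewrite /= E. Qed.

Lemma reach_store a s va vs : nth IHalt p pc = IStore a s -> m a = va ->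
  m s = vs ->
  reach p c (pc.+1, upd m (addr va) vs) Q -> reach p c.+1 (pc, m) Q.
Proof. by move=> E <- <-; apply: reach_step; rewrite /= E. Qed.

(** For a load from an address that is not a known numeral: the value stays a variable, tied to
    memory by an equation only. *)
Lemma reach_load_abs d a va : nth IHalt p pc = ILoad d a -> m a = va ->
  (forall v, v = m (addr va) -> reach p c (pc.+1, upd m d v) Q) ->
  reach p c.+1 (pc, m) Q.
Proof. by move=> E <- H; apply: reach_step (H _ erefl); rewrite /= E. Qed.

Lemma reach_jlt a b t va vb : nth IHalt p pc = IJlt a b t -> m a = va ->
  m b = vb ->
  reach p c (if va < vb then t else pc.+1, m) Q -> reach p c.+1 (pc, m) Q.
Proof. by move=> E <- <-; apply: reach_step; rewrite /= E. Qed.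

Lemma reach_jmp t : nth IHalt p pc = IJmp t ->
  reach p c (t, m) Q -> reach p c.+1 (pc, m) Q.
Proof. by move=> E; apply: reach_step; rewrite /= E. Qed.
End Rules.
End Ram.

Arguments reach : simpl never.

(** Reads a cell through a chain of updates. Literal addresses are told apart by computation, hence
    the premise of [upd_other] as an equation with [true]. *)
Ltac look := lazymatch goal with
  | |- upd ?m ?d ?v ?d = _ => exact (upd_same m d v)
  | |- upd ?m ?d ?v ?a = _ =>
      etransitivity; [apply: upd_other; reflexivity | look]
  | |- _ => eassumption
  end.

Ltac exec1 := first
  [ eapply reach_cst; [reflexivity|]
  | eapply reach_add; [reflexivity|look|look|]
  | eapply reach_sub; [reflexivity|look|look|]
  | eapply reach_mul; [reflexivity|look|look|]
  | eapply reach_floor; [reflexivity|look|]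
  | eapply reach_jmp; [reflexivity|]
  | eapply reach_jlt; [reflexivity|look|look|]
  | eapply reach_store; [reflexivity|look|look|]
  | eapply reach_load; [reflexivity|look| |] ].

(* Registers: 0 and 1 hold n and k; 2 and 3 the constants 1 and 0; 4 a counter, 5 a
   pointer, 6 and 7 the current point; 8 the number g of tiles per side, 9 the table
   resolution G, 10 the number of sites per tile, 11 the table, 12 the slot array;
   13 to 16 are scratch.  They overwrite the input points of index below 15, which are
   therefore ignored.  The configurations are stored from address 2n + 32 on, each as
   its number of sites followed by its G * G table entries. *)
Definition ram_main (K G L0 : nat) : seq instr := [::
  (*  0 *) ICst 2 1%Z;
  (*  1 *) ICst 3 0%Z;
  (*  2 *) IAdd 11 0 0;
  (*  3 *) ICst 13 32%Z;
  (*  4 *) IAdd 11 11 13;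
  (*  5 *) IAdd 12 11 3;
  (*  6 *) IJmp L0;
  (*  7 *) ICst 9 (Posz G);
  (*  8 *) ICst 13 (Posz K);
  (*  9 *) IJlt 13 1 11;
  (* 10 *) IAdd 13 1 3;
  (* 11 *) ICst 14 (Posz (G * G).+1);
  (* 12 *) IMul 13 13 14;
  (* 13 *) IAdd 11 11 13;
  (* 14 *) ILoad 10 11;
  (* 15 *) IAdd 11 11 2;
  (* 16 *) ICst 8 1%Z;
  (* 17 *) IMul 13 8 8;
  (* 18 *) IMul 13 13 10;
  (* 19 *) IJlt 13 1 21;
  (* 20 *) IJmp 23;
  (* 21 *) IAdd 8 8 2;
  (* 22 *) IJmp 17;
  (* 23 *) ICst 4 15%Z;
  (* 24 *) ICst 5 32%Z;
  (* 25 *) IJlt 4 0 27;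
  (* 26 *) IJmp 58;
  (* 27 *) ILoad 6 5;
  (* 28 *) IAdd 5 5 2;
  (* 29 *) ILoad 7 5;
  (* 30 *) IAdd 5 5 2;
  (* 31 *) IMul 6 6 8;
  (* 32 *) IFloor 15 6;
  (* 33 *) ISub 6 6 15;
  (* 34 *) IMul 6 6 9;
  (* 35 *) IFloor 6 6;
  (* 36 *) IMul 7 7 8;
  (* 37 *) IFloor 16 7;
  (* 38 *) ISub 7 7 16;
  (* 39 *) IMul 7 7 9;
  (* 40 *) IFloor 7 7;
  (* 41 *) IMul 6 6 9;
  (* 42 *) IAdd 6 6 7;
  (* 43 *) IAdd 6 6 11;
  (* 44 *) ILoad 13 6;
  (* 45 *) IJlt 13 2 56;
  (* 46 *) IMul 14 15 8;
  (* 47 *) IAdd 14 14 16;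
  (* 48 *) IMul 14 14 10;
  (* 49 *) IAdd 14 14 13;
  (* 50 *) ISub 14 14 2;
  (* 51 *) IJlt 14 3 56;
  (* 52 *) IJlt 14 1 54;
  (* 53 *) IJmp 56;
  (* 54 *) IAdd 14 14 12;
  (* 55 *) IStore 14 4;
  (* 56 *) IAdd 4 4 2;
  (* 57 *) IJmp 25;
  (* 58 *) ICst 4 32%Z;
  (* 59 *) IAdd 5 12 4;
  (* 60 *) IJlt 4 1 62;
  (* 61 *) IJmp 67;
  (* 62 *) ILoad 13 5;
  (* 63 *) IStore 4 13;
  (* 64 *) IAdd 4 4 2;
  (* 65 *) IAdd 5 5 2;
  (* 66 *) IJmp 60;
  (* 67 *) ICst 13 31%Z;
  (* 68 *) IAdd 0 12 13;
  (* 69 *) ICst 1 1%Z].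

(** The output overlaps the registers, so cells 31 down to 2 are filled by unrolled code that relies
    only on register 0 as a pointer and register 1 as the constant 1. *)
Definition ram_tail : seq instr :=
  flatten [seq [:: ILoad d 0; ISub 0 0 1] | d <- rev (iota 2 30)] ++
  [:: ISub 0 0 1; IAdd 1 0 1; ILoad 1 1; ILoad 0 0; IHalt].

Definition ram_data (dat : seq nat) : seq instr :=
  flatten [seq [:: ICst 13 (Posz v); IStore 12 13; IAdd 12 12 2] | v <- dat]
  ++ [:: IJmp 7].

(** [135] is the joint length of [ram_main] (70) and [ram_tail] (65). The block whose length depends
    on the tables comes last, so that all other code addresses are literals. *)
Definition ram_prog (K G : nat) (dat : seq nat) : seq instr :=
  ram_main K G 135 ++ ram_tail ++ ram_data dat.

(** * Execution of the setup, of the search for the tile count and of one pass of the point loop *)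

Section Exec.
Variable R : realType.
Variables (K G : nat) (dat : seq nat).
Let p := ram_prog K G dat.
Implicit Type m : nat -> R.

Section Input.
Variables (n k : nat).
(** The tables start at [D], beyond the input and the registers; the slot array starts at [Tb], just
    past the tables. *)
Let D := (n + n + 32)%N.
Let Tb := (D + size dat)%N.

Lemma ram_data_nth (i : nat) : (i < size dat)%N ->
  [/\ nth IHalt p (135 + 3 * i) = ICst 13 (Posz (nth 0%N dat i)),
      nth IHalt p (136 + 3 * i) = IStore 12 13 &
      nth IHalt p (137 + 3 * i) = IAdd 12 12 2].
Proof.
move=> lt_i.
have E r : nth IHalt p (135 + r) = nth IHalt (ram_data dat) r by [].
have E1 : nth IHalt p (136 + 3 * i) = nth IHalt (ram_data dat) (3 * i + 1).
  by rewrite -E; congr nth; lia.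
have E2 : nth IHalt p (137 + 3 * i) = nth IHalt (ram_data dat) (3 * i + 2).
  by rewrite -E; congr nth; lia.
rewrite E E1 E2 {E E1 E2} /ram_data.
elim: dat i lt_i => // v l IH [|i] // lt_i.
by rewrite (_ : 3 * i.+1 = (3 * i).+3)%N; [exact: IH | lia].
Qed.

Lemma ram_data_end : nth IHalt p (135 + 3 * size dat) = IJmp 7.
Proof.
have E r : nth IHalt p (135 + r) = nth IHalt (ram_data dat) r by [].
rewrite E /ram_data; elim: dat => // v l IH.
by rewrite (_ : 3 * size (v :: l) = (3 * size l).+3)%N; [exact: IH | move=> /=; lia].
Qed.

(** Register 12 is the write pointer here; it stops at [Tb] and thereby becomes the base of the slot
    array. *)
Lemma ram_data_loop (c i : nat) m :
  (c + i = size dat)%N -> m 2%N = 1%:R -> m 12%N = (D + i)%:R ->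
  reach p (3 * c + 1) (135 + 3 * i, m)%N
   (fun s => [/\ s.1 = 7%N, s.2 12%N = Tb%:R,
     forall a, (a < 12)%N -> s.2 a = m a,
     forall a, (32 <= a < D + i)%N -> s.2 a = m a &
     forall l, (i <= l < size dat)%N -> s.2 (D + l)%N = (nth 0%N dat l)%:R]).
Proof.
elim: c i m => [|c IH] i m eq_i m2 m12.
  have -> : i = size dat by lia.
  eapply reach_jmp; first exact: ram_data_end.
  apply: reach_done; split=> //= [|l]; last by lia.
  by rewrite m12 /Tb; congr (_%:R); lia.
have lt_i : (i < size dat)%N by lia.
have [N1 N2 N3] := ram_data_nth lt_i.
rewrite (_ : 3 * c.+1 + 1 = (3 * c + 1).+3)%N; last by lia.
eapply reach_cst; first exact: N1.
eapply reach_store; [exact: N2|look|look|].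
rewrite addr_nat.
have D13 : (32 <= D + i)%N by rewrite /D; lia.
eapply reach_add; [exact: N3| | |].
- by etransitivity; [apply: upd_other; apply/negP => /eqP; lia|look].
- by etransitivity; [apply: upd_other; apply/negP => /eqP; lia|look].
set m' := upd _ _ _.
rewrite (_ : (135 + 3 * i).+3 = 135 + 3 * i.+1)%N; last by lia.
have lowE a : (a < 12)%N -> m' a = m a.
  by move=> lt_a; rewrite /m' !upd_other //; apply/negP => /eqP; lia.
have highE a : (32 <= a)%N -> a != (D + i)%N -> m' a = m a.
  by move=> lt_a ne; rewrite /m' !upd_other //; apply/negP => /eqP; lia.
apply: (reach_le (leqnn _)); rewrite -[(3 * c + 1)%N]addn0.
apply: reach_seq; first apply: IH.
- by lia.
- by rewrite lowE.
- by rewrite /m' upd_same -natrD; congr (_%:R); lia.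
move=> [pc m1] /= [-> H12 Hlow Hmid Hhigh]; left; split=> //=.
- by move=> a lt_a; rewrite Hlow // lowE.
- move=> a lt_a; rewrite Hmid; last by lia.
  by rewrite highE //; lia.
move=> l lt_l; have [eq_l|ne_l] := eqVneq l i; last by apply: Hhigh; lia.
rewrite eq_l Hmid; last by lia.
by rewrite /m' upd_low // upd_same.
Qed.

Variable pts : 'I_n -> R * R.

Definition ram_frame m :=
  (forall a, (32 <= a < D)%N -> m a = init_mem k pts a) /\
  (forall l, (l < size dat)%N -> m (D + l)%N = (nth 0%N dat l)%:R).

Lemma ram_frame_eq m m' :
  (forall a, (32 <= a < Tb)%N -> m' a = m a) -> ram_frame m -> ram_frame m'.
Proof.
move=> E [H1 H2]; split=> [a lt_a|l lt_l].
  by rewrite E ?H1 //; rewrite /Tb; lia.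
by rewrite E ?H2 //; rewrite /Tb /D; lia.
Qed.

(** Block [e] of the tables is the one in use: each [k < K] will have its own, and block [K] serves
    all remaining [k]. *)
Let e := minn k K.
Let mm := nth 0%N dat (e * (G * G).+1).
Let tabp := (D + e * (G * G).+1).+1.

Definition ram_base m :=
  [/\ m 0%N = n%:R, m 1%N = k%:R, m 2%N = 1%:R, m 3%N = 0%:R &
    [/\ m 9%N = G%:R, m 10%N = mm%:R, m 11%N = tabp%:R & m 12%N = Tb%:R]].

Hypothesis entry_lt : (e * (G * G).+1 < size dat)%N.

Lemma ram_setup :
  reach p ((3 * size dat + 1) + 10).+4.+3 (init_state k pts)
    (fun s => [/\ s.1 = 17%N, ram_base s.2, s.2 8%N = 1%:R & ram_frame s.2]).
Proof.
set m := init_mem k pts.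
have m0 : m 0%N = n%:R by [].
have m1 : m 1%N = k%:R by [].
rewrite /init_state -/m; do 7 exec1; set m' := upd _ 12 _.
have h2 : m' 2%N = 1%:R by rewrite /m'; look.
have h12 : m' 12%N = (D + 0)%:R by rewrite /m' upd_same addr0 addn0 !natrD.
apply: reach_seq; first exact: (ram_data_loop (c := size dat) (addn0 _) h2 h12).
move=> [pc m2] /= [-> H12 Hlow Hmid Hhigh].
have h0 : m2 0%N = n%:R by rewrite Hlow.
have h1 : m2 1%N = k%:R by rewrite Hlow.
have {}h2 : m2 2%N = 1%:R by rewrite Hlow.
have h3 : m2 3%N = 0%:R by rewrite Hlow.
have h11 : m2 11%N = D%:R by rewrite Hlow // /m' /D !natrD.
have Fr : ram_frame m2.
  split=> [a lt_a|l lt_l]; last exact: Hhigh.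
  by rewrite Hmid /m'; [rewrite !upd_low //; lia|lia].
(* Both outcomes of the comparison of [K] with [k] continue at instruction 11 with [e] in register
   13. *)
have he (z : R) m3 : z = e%:R ->
   m3 0%N = n%:R -> m3 1%N = k%:R -> m3 2%N = 1%:R -> m3 3%N = 0%:R ->
   m3 9%N = G%:R -> m3 11%N = D%:R -> m3 12%N = Tb%:R -> m3 13%N = z ->
   ram_frame m3 ->
   reach p 6 (11%N, m3) (fun s => [/\ s.1 = 17%N, ram_base s.2, s.2 8%N = 1%:R & ram_frame s.2]).
  move=> -> g0 g1 g2 g3 g9 g11 g12 g13 Frm.
  have tE : (D%:R + e%:R * ((G * G).+1%:Z)%:~R : R) = (D + e * (G * G).+1)%:R.
    by rewrite natrD natrM.
  do 3 exec1.
  eapply reach_load; [reflexivity|look| |].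
    rewrite tE addr_nat !upd_low; try by rewrite /D; lia.
    by have [_ ->] := Frm.
  do 2 exec1; apply: reach_done; split=> //=; last first.
    by apply: ram_frame_eq Frm => a lt_a; rewrite !upd_low //; lia.
  split; try by look.
  split; try by look.
  by rewrite upd_other // upd_same tE natr1.
do 3 exec1; case: ltP => hk.
  apply: (@reach_le _ _ 6) => //; apply: he (erefl _) _ _ _ _ _ _ _ _ _; try by look.
  - by rewrite /e (minn_idPr _) // -(ler_nat R); apply: ltW.
  - apply: ram_frame_eq Fr => a lt_a; rewrite !upd_low //; lia.
exec1; apply: he (erefl _) _ _ _ _ _ _ _ _ _; try by look.
- by rewrite addr0 /e (minn_idPl _) // -(ler_nat R).
- apply: ram_frame_eq Fr => a lt_a; rewrite !upd_low //; lia.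
Qed.

(** Linear search for the least positive [g] with [k <= g * g * mm]. Any [g >= k] qualifies, so [c]
    bounds the remaining rounds. The alternative [g = 1] is there for [k = 0]. *)
Lemma ram_grid (c g : nat) m :
  (0 < mm)%N -> (k < c + g)%N -> (0 < g)%N -> (g.-1 * g.-1 * mm < k \/ g = 1)%N ->
  ram_base m -> m 8%N = g%:R -> ram_frame m ->
  reach p (5 * c + 4) (17%N, m)
    (fun s => [/\ s.1 = 23%N, ram_base s.2, ram_frame s.2 &
      exists g, [/\ (0 < g)%N, s.2 8%N = g%:R, (k <= g * g * mm)%N &
                 (g.-1 * g.-1 * mm < k)%N \/ g = 1%N]]).
Proof.
move=> mm0; elim: c g m => [|c IH] g m lt_k g0 gP Bm m8 Fm.
  have le_k : (k <= g * g * mm)%N.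
    by move: lt_k g0 mm0; clear; nia.
  rewrite (_ : 5 * 0 + 4 = 4)%N //.
  have [h0 h1 h2 h3 [h9 h10 h11 h12]] := Bm.
  do 3 exec1; rewrite -!natrM ltr_nat ltnNge le_k /=.
  exec1; apply: reach_done; split=> //=.
  - by apply: ram_frame_eq Fm => a lt_a; rewrite !upd_low //; lia.
  - by exists g; split=> //; look.
have [h0 h1 h2 h3 [h9 h10 h11 h12]] := Bm.
rewrite (_ : 5 * c.+1 + 4 = (5 * c + 4).+4.+1)%N; last by lia.
do 3 exec1; rewrite -!natrM ltr_nat; case: ltnP => le_k.
  do 2 exec1; apply: (IH g.+1) => //.
  - by lia.
  - by left.
  - by rewrite upd_same natr1.
  - by apply: ram_frame_eq Fm => a lt_a; rewrite !upd_low //; lia.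
exec1; apply: reach_done; split=> //=.
- by apply: ram_frame_eq Fm => a lt_a; rewrite !upd_low //; lia.
- by exists g; split=> //; look.
Qed.

Section Main.
Variable g : nat.

Definition ram_loop_inv (i : nat) m :=
  [/\ ram_base m, ram_frame m, m 8%N = g%:R, m 4%N = i%:R &
      m 5%N = (i + i + 2)%:R].

(** The table address as the machine computes it, for arbitrary real inputs; for points of the
    half-open unit square it is shown below to agree with [cell]. *)
Definition ram_cell (x y : R) : R :=
  let tx := (Num.floor (x * g%:R))%:~R in
  let ty := (Num.floor (y * g%:R))%:~R in
  (Num.floor ((x * g%:R - tx) * G%:R))%:~R * G%:R +
  (Num.floor ((y * g%:R - ty) * G%:R))%:~R + tabp%:R.

Definition ram_slot (x y v : R) : R :=
  ((Num.floor (x * g%:R))%:~R * g%:R + (Num.floor (y * g%:R))%:~R) * mm%:R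
  + v - 1.

Definition ram_writes (x y v : R) :=
  [&& 1 <= v, 0 <= ram_slot x y v & ram_slot x y v < k%:R].

(* The table load may hit a register when the input lies outside the unit square,
   hence the guard on the value of [v]; termination must not depend on it. *)
Lemma ram_body (i : nat) m : (i < n)%N -> (15 <= i)%N -> ram_loop_inv i m ->
  let x := m (i + i + 2)%N in let y := m (i + i + 3)%N in
  reach p 40 (25%N, m)
    (fun s => [/\ s.1 = 25%N, ram_loop_inv i.+1 s.2 &
      exists2 v, (32 <= addr (ram_cell x y))%N -> v = m (addr (ram_cell x y)) &
        forall a, (32 <= a)%N -> s.2 a =
          if ram_writes x y v && (a == addr (ram_slot x y v + Tb%:R))
          then i%:R else m a]).
Proof.
move=> lt_i le_i [Bm Fm m8 m4 m5] x y.
have [h0 h1 h2 h3 [h9 h10 h11 h12]] := Bm.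
exec1; rewrite ltr_nat lt_i.
eapply reach_load; [reflexivity|look| |].
  by rewrite addr_nat; reflexivity.
rewrite -/x; exec1.
eapply reach_load; [reflexivity|look| |].
  rewrite natr1 addr_nat !upd_low; [|by lia..].
  by rewrite (_ : (i + i + 2).+1 = i + i + 3)%N; [reflexivity|lia].
rewrite -/y; do 14 exec1.
eapply reach_load_abs; [reflexivity|look|] => v vE.
have vP : (32 <= addr (ram_cell x y))%N -> v = m (addr (ram_cell x y)).
  by move=> h; rewrite vE !upd_low.
move: vP => {vE} vP.
(* All paths through the loop body meet at instruction 56; they differ only in what the slot array
   received. *)
have done_ c m' : ram_base m' -> m' 8%N = g%:R -> m' 4%N = i%:R ->
    m' 5%N = (i + i + 2)%:R + 1 + 1 ->
    (forall a, (32 <= a < Tb)%N -> m' a = m a) ->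
    (forall a, (32 <= a)%N -> m' a =
          if ram_writes x y v && (a == addr (ram_slot x y v + Tb%:R))
          then i%:R else m a) ->
  reach p c.+2 (56%N, m')
    (fun s => [/\ s.1 = 25%N, ram_loop_inv i.+1 s.2 &
      exists2 v, (32 <= addr (ram_cell x y))%N -> v = m (addr (ram_cell x y)) &
        forall a, (32 <= a)%N -> s.2 a =
          if ram_writes x y v && (a == addr (ram_slot x y v + Tb%:R))
          then i%:R else m a]).
  move=> [g0 g1 g2 g3 [g9 g10 g11 g12]] g8 g4 g5 lowE wE.
  do 2 exec1; apply: reach_done; split; first by [].
    split.
    - by split; [look..|split; look].
    - by apply: ram_frame_eq Fm => a lt_a; rewrite /= upd_low ?lowE //; lia.
    - by look.
    - by rewrite /= upd_same natr1.
    - by rewrite /= upd_other // g5 !natr1; congr (_%:R); lia.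
  by exists v => // a lt_a; rewrite /= upd_low // wE.
exec1; case: ltP => v1.
  apply: done_.
  - by split; [look..|split; look].
  - by look.
  - by look.
  - by look.
  - by move=> a lt_a; rewrite !upd_low //; lia.
  - by move=> a lt_a; rewrite !upd_low // /ram_writes leNgt v1.
do 5 exec1; rewrite -/(ram_slot x y v).
exec1; case: ltP => J0.
  apply: done_.
  - by split; [look..|split; look].
  - by look.
  - by look.
  - by look.
  - by move=> a lt_a; rewrite !upd_low //; lia.
  - by move=> a lt_a; rewrite !upd_low // /ram_writes [0 <= _]leNgt J0 andbF.
exec1; case: ltP => Jk; last first.
  exec1; apply: done_.
  - by split; [look..|split; look].
  - by look.
  - by look.
  - by look.
  - by move=> a lt_a; rewrite !upd_low //; lia.
  - by move=> a lt_a; rewrite !upd_low // /ram_writes [_ < k%:R]ltNge Jk !andbF.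
exec1; eapply reach_store; [reflexivity|look|look|].
move: {-2}(addr _) (erefl (addr (ram_slot x y v + Tb%:R))) => A AE.
(* The test for a nonnegative slot number keeps the store off the registers, the input and the
   tables. *)
have TA : (Tb <= A)%N.
  rewrite AE /addr truncn_ge_nat; first by rewrite lerDr.
  by rewrite addr_ge0.
have lowA m' w a : (a < Tb)%N -> upd m' A w a = m' a.
  by move=> lt_a; rewrite upd_other //; apply/negP => /eqP; lia.
have T32 : (32 <= Tb)%N by rewrite /Tb /D; lia.
apply: done_.
- by split; [rewrite lowA; [look|lia]..|split; rewrite lowA; [look|lia|look|lia|look|lia|look|lia]].
- by rewrite lowA; [look|lia].
- by rewrite lowA; [look|lia].
- by rewrite lowA; [look|lia].
- by move=> a lt_a; rewrite lowA ?upd_low //; lia.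
- move=> a lt_a; rewrite /ram_writes v1 J0 Jk -AE /=.
  have [->|ne] := eqVneq a A; first exact: upd_same.
  by rewrite upd_other // !upd_low.
Qed.

End Main.

End Input.
End Exec.

(** * Tiles, grid cells and slots *)

Section Slots.
Variable R : realType.

Definition tile (g : nat) (x : R) : nat := Num.truncn (x * g%:R).
Definition local (g : nat) (x : R) : R := x * g%:R - (tile g x)%:R.
Definition cell (G : nat) (p : R * R) : nat :=
  (Num.truncn (p.1 * G%:R) * G + Num.truncn (p.2 * G%:R))%N.

(** Half-open, so that tile indices stay below [g]; a coordinate equal to 1 has probability zero. *)
Definition in_unit (p : R * R) := (0 <= p.1 < 1) && (0 <= p.2 < 1).

(** A table value 0 means no site and [v.+1] means site [v], hence [j.+1] in the equation. *)
Definition hit (G m g : nat) (tab : nat -> nat) (p : R * R) (j : nat) : Prop :=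
  let v := tab (cell G (local g p.1, local g p.2)) in
  (0 < v)%N /\ j.+1 = ((tile g p.1 * g + tile g p.2) * m + v)%N.

Lemma floor_truncn (z : R) : 0 <= z -> (Num.floor z)%:~R = (Num.truncn z)%:R :> R.
Proof.
move=> z0; rewrite truncn_floor z0 -{1}[Num.floor z]gez0_abs //.
by rewrite floor_ge0.
Qed.

Lemma tile_itv (g : nat) (x : R) : 0 <= x ->
  (tile g x)%:R <= x * g%:R < (tile g x).+1%:R.
Proof. by move=> x0; apply: truncn_itv; rewrite mulr_ge0. Qed.

Lemma tile_lt (g : nat) (x : R) : (0 < g)%N -> 0 <= x < 1 -> (tile g x < g)%N.
Proof.
move=> g0 /andP[x0 x1]; rewrite /tile truncn_lt_nat ?mulr_ge0 //.
by rewrite gtr_pMl // ltr0n.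
Qed.

Lemma local_itv (g : nat) (x : R) : 0 <= x -> 0 <= local g x < 1.
Proof.
move=> /(tile_itv g)/andP[h1 h2]; rewrite /local subr_ge0 h1 /=.
by rewrite ltrBlDr addrC natr1.
Qed.

Lemma cell_lt (G : nat) (p : R * R) : (0 < G)%N -> in_unit p -> (cell G p < G * G)%N.
Proof.
move=> G0 /andP[/(tile_lt G0) h1 /(tile_lt G0) h2]; rewrite /cell.
by move: h1 h2; rewrite /tile; nia.
Qed.

End Slots.

(** * What a complete run leaves in the output cells *)

Section Correct.
Variable R : realType.
Variables (K G : nat) (dat : seq nat).
Hypothesis G0 : (0 < G)%N.
Let p := ram_prog K G dat.
Implicit Type m : nat -> R.

Variables (n k : nat).
Hypothesis le_kn : (k <= n)%N.
Let D := (n + n + 32)%N.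
Let Tb := (D + size dat)%N.
Let e := minn k K.
Let mm := nth 0%N dat (e * (G * G).+1).
Let tab (c : nat) := nth 0%N dat (e * (G * G).+1 + c.+1).
Let tabp := (D + e * (G * G).+1).+1.
Hypothesis entry_le : (e.+1 * (G * G).+1 <= size dat)%N.
Variable pts : 'I_n -> R * R.
Notation base := (ram_base K G dat n k).
Notation frame := (ram_frame dat k pts).

Let entry_lt : (e * (G * G).+1 < size dat)%N.
Proof. by move: entry_le; lia. Qed.

Section Grid.
Variable g : nat.
Hypothesis g0 : (0 < g)%N.
Notation inv := (ram_loop_inv K G dat k pts g).
Notation thit := (hit G mm g tab).

Lemma init_mem_point (i : 'I_n) : (15 <= i)%N ->
  init_mem k pts (i + i + 2)%N = (pts i).1 /\
  init_mem k pts (i + i + 3)%N = (pts i).2.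
Proof.
move=> le_i; rewrite /init_mem.
have -> : (i + i + 2 == 0)%N = false by lia.
have -> : (i + i + 2 == 1)%N = false by lia.
have -> : (i + i + 3 == 0)%N = false by lia.
have -> : (i + i + 3 == 1)%N = false by lia.
have -> : ((i + i + 2 - 2)./2 = i)%N by lia.
have -> : ((i + i + 3 - 2)./2 = i)%N by lia.
have -> : odd (i + i + 2) = false by lia.
have -> : odd (i + i + 3) = true by lia.
by rewrite valK.
Qed.

Lemma ram_cellE (q : R * R) : in_unit q ->
  addr (ram_cell K G n k g q.1 q.2) =
    (tabp + cell G (local g q.1, local g q.2))%N.
Proof.
move=> /andP[/andP[x0 x1] /andP[y0 y1]]; rewrite /ram_cell.
have [/andP[lx _] /andP[ly _]] := (local_itv g x0, local_itv g y0).
rewrite (floor_truncn (mulr_ge0 x0 (ler0n _ g))).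
rewrite (floor_truncn (mulr_ge0 y0 (ler0n _ g))).
rewrite -/(tile g q.1) -/(tile g q.2) -/(local g q.1) -/(local g q.2).
rewrite (floor_truncn (mulr_ge0 lx (ler0n _ G))).
rewrite (floor_truncn (mulr_ge0 ly (ler0n _ G))).
by rewrite -natrM -!natrD addr_nat /cell addnC.
Qed.

Lemma ram_writesE (q : R * R) (j : nat) : in_unit q -> (j < k)%N ->
  let v := (tab (cell G (local g q.1, local g q.2)))%:R in
  ram_writes K G dat k g q.1 q.2 v &&
    (Tb + j == addr (ram_slot K G dat k g q.1 q.2 v + Tb%:R))%N <-> thit q j.
Proof.
move=> /andP[/andP[x0 x1] /andP[y0 y1]] lt_j v.
rewrite /ram_writes /hit.
have E : ram_slot K G dat k g q.1 q.2 v =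
  ((tile g q.1 * g + tile g q.2) * mm + tab (cell G (local g q.1, local g q.2)))%:R - 1.
  rewrite /ram_slot (floor_truncn (mulr_ge0 x0 (ler0n _ g))).
  by rewrite (floor_truncn (mulr_ge0 y0 (ler0n _ g))) natrD natrM natrD natrM.
rewrite {}E /v ler1n; set w := tab _; set N := (_ * mm + w)%N.
case: (ltnP 0 w) => w0 /=; last by split=> // -[].
have -> : N = N.-1.+1 by rewrite prednK // /N; lia.
rewrite -natr1 addrK ler0n ltr_nat -natrD addr_nat; split.
  by move=> /andP[_ /eqP h]; split=> //; lia.
by move=> [_ h]; apply/andP; split; [lia | apply/eqP; lia].
Qed.

(** The unit square is a premise inside the invariant because the time bound must hold for every
    input. The recorded point may differ from the given one, as later hits overwrite earlier
    ones. *)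
Definition table_ok (i : nat) m :=
  (forall i : 'I_n, in_unit (pts i)) ->
  forall j, (j < k)%N ->
  (exists2 i' : 'I_n, (15 <= i' < i)%N & thit (pts i') j) ->
  exists2 i' : 'I_n, (15 <= i')%N /\ thit (pts i') j & m (Tb + j)%N = i'%:R.

Lemma ram_loop (c i : nat) m : (n <= c + i)%N -> (15 <= i)%N -> 
  inv i m -> table_ok i m ->
  reach p (40 * c + 2) (25%N, m)
    (fun s => [/\ s.1 = 58%N, base s.2 & table_ok n s.2]).
Proof.
elim: c i m => [|c IH] i m le_n le_i Im Tm.
  have le_ni : (n <= i)%N by lia.
  have [[h0 h1 h2 h3 [h9 h10 h11 h12]] Fm m8 m4 m5] := Im.
  rewrite (_ : 40 * 0 + 2 = 2)%N //.
  exec1; rewrite ltr_nat ltnNge le_ni /=; exec1; apply: reach_done; split=> //=.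
  by move=> inU j lt_j [i' hi' hj]; apply: Tm => //; exists i' => //; lia.
have [le_ni|lt_in] := leqP n i.
  by apply: reach_le (IH i m _ le_i Im Tm); lia.
rewrite (_ : 40 * c.+1 + 2 = 40 + (40 * c + 2))%N; last by lia.
have B := ram_body entry_lt lt_in le_i Im; cbv zeta in B.
apply: (reach_seq B) => {B}.
move=> [pc m'] /= [-> Im' [v vE H]]; apply: (IH i.+1) => //; try by lia.
move=> inU j lt_j [i' hi' hj].
have [Bm [F1 F2] m8 m4 m5] := Im.
pose I := Ordinal lt_in.
have lt_Di : (i + i + 3 < D)%N by rewrite /D; lia.
have [P1 P2] := init_mem_point (le_i : (15 <= I)%N).
have M1 : m (i + i + 2)%N = (pts I).1 by rewrite F1 //; lia.
have M2 : m (i + i + 3)%N = (pts I).2 by rewrite F1 //; lia.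
move: vE H; rewrite M1 M2 ram_cellE //.
set cl := cell _ _ => vE H.
have lt_c : (cl < G * G)%N.
  by case/andP: (inU I) => /andP[x0 _] /andP[y0 _]; apply: cell_lt => //; apply/andP; split; apply: local_itv.
have {}vE : v = (tab cl)%:R.
  rewrite vE; last by rewrite /tabp /D; lia.
  rewrite (_ : tabp + cl = D + (e * (G * G).+1 + cl.+1))%N; last by rewrite /tabp; lia.
  by rewrite F2 //; move: entry_le; lia.
have HT := H (Tb + j)%N.
rewrite vE in HT.
have T32 : (32 <= Tb + j)%N by rewrite /Tb /D; lia.
move: (HT T32) => {}HT.
have W := ram_writesE (inU I) lt_j.
case: ifP HT => [cnd HT | cnd HT].
  by exists I; [split=> //; apply/W | rewrite HT].
have ne : i' != I.
  by apply/eqP => E; move: cnd => /negP; apply; apply/W; rewrite -E.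
have [|i'' h1 h2] := Tm inU j lt_j.
  by exists i' => //; move: ne; rewrite -val_eqE /=; lia.
by exists i'' => //; rewrite HT.
Qed.

End Grid.
(** Cells from 32 on are written first, while the registers are still in use. A target [a < k <= n]
    lies below [Tb], so the slot array stays intact. *)
Lemma ram_copy (c a : nat) m (T : nat -> R) :
  (k <= c + a)%N -> (32 <= a)%N ->
  m 1%N = k%:R -> m 2%N = 1%:R -> m 12%N = Tb%:R ->
  m 4%N = a%:R -> m 5%N = (Tb + a)%:R ->
  (forall j, (32 <= j < a)%N -> (j < k)%N -> m j = T j) ->
  (forall j, m (Tb + j)%N = T j) ->
  reach p (6 * c + 2) (60%N, m)
    (fun s => [/\ s.1 = 67%N, s.2 12%N = Tb%:R,
      forall j, (32 <= j < k)%N -> s.2 j = T j &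
      forall j, s.2 (Tb + j)%N = T j]).
Proof.
elim: c a m => [|c IH] a m le_k le_a h1 h2 h12 h4 h5 cpd TbT.
  rewrite (_ : 6 * 0 + 2 = 2)%N //; exec1; rewrite ltr_nat ltnNge le_k /=.
  by exec1; apply: reach_done; split=> //= j lt_j; apply: cpd; lia.
rewrite (_ : 6 * c.+1 + 2 = (6 * c + 2).+4.+2)%N; last by lia.
exec1; rewrite ltr_nat; case: ltnP => lt_a; last first.
  by exec1; apply: reach_done; split=> //= j lt_j; apply: cpd; lia.
have T32 : (32 <= Tb)%N by rewrite /Tb /D; lia.
have lt_aT : (a < Tb)%N by rewrite /Tb /D; lia.
eapply reach_load; [reflexivity|look|by rewrite addr_nat TbT; reflexivity|].
eapply reach_store; [reflexivity|look|look|]; rewrite addr_nat.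
have lowA d w : (d < 13)%N -> upd (upd m 13 w) a w d = m d.
  by move=> lt_d; rewrite !upd_other //; apply/negP => /eqP; lia.
have highA j w : (32 <= j)%N -> j != a -> upd (upd m 13 w) a w j = m j.
  by move=> le_j ne; rewrite upd_other // upd_low.
move: (upd_same (upd m 13 (T a)) a (T a)) (fun d => @lowA d (T a)) (fun j => @highA j (T a)).
move: (upd _ a _) => m' m'a {lowA highA}lowA highA.
have l1 := lowA 1%N isT; have l2 := lowA 2%N isT; have l12 := lowA 12%N isT.
have l4 := lowA 4%N isT; have l5 := lowA 5%N isT.
rewrite h1 in l1; rewrite h2 in l2; rewrite h12 in l12.
rewrite h4 in l4; rewrite h5 in l5.
do 3 exec1; apply: (IH a.+1); try look; try by lia.
- by rewrite upd_other // upd_same natr1.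
- by rewrite upd_same natr1 addnS.
- move=> j le_j lt_j; rewrite !upd_low; [|by lia..].
  have [->|ne] := eqVneq j a; first exact: m'a.
  by rewrite highA //; [apply: cpd => //|]; lia.
- move=> j; rewrite !upd_low; [|by lia..].
  by rewrite highA ?TbT //; lia.
Qed.

Lemma ram_tail_nth d : (2 <= d <= 31)%N ->
  nth IHalt p (132 - (d + d)) = ILoad d 0 /\
  nth IHalt p (132 - (d + d)).+1 = ISub 0 0 1.
Proof.
do 32 (destruct d as [|d]; [by []|]); by [].
Qed.

Lemma ram_tail_loop (d : nat) m (T : nat -> R) :
  (1 <= d <= 31)%N -> m 0%N = (Tb + d)%:R -> m 1%N = 1%:R ->
  (forall j, (d < j)%N -> (j < k)%N || (j < 32)%N -> m j = T j) ->
  (forall j, m (Tb + j)%N = T j) ->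
  reach p (d + d + 2) (132 - (d + d), m)%N
    (fun s => step p s = None /\ forall j, (j < k)%N -> s.2 j = T j).
Proof.
have T32 : (32 <= Tb)%N by rewrite /Tb /D; lia.
elim: d m => // d IH m le_d m0 m1 done_T TbT.
case: d IH le_d m0 done_T => [|d] IH le_d m0 done_T.
  (* Only cells 1 and 0 remain: register 1 becomes the address of its own source and is replaced
     before register 0, which by then points to slot 0. *)
  rewrite (_ : 132 - (1 + 1) = 130)%N // (_ : 1 + 1 + 2 = 4)%N //.
  do 2 exec1.
  have E : (Tb + 1)%:R - 1 = Tb%:R :> R by rewrite natrD addrK.
  eapply reach_load; [reflexivity|look| |].
    rewrite [X in addr X](_ : _ = (Tb + 1)%:R); last by rewrite subrK.
    rewrite addr_nat.
    by rewrite !upd_low ?TbT; [reflexivity|lia..].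
  eapply reach_load; [reflexivity|look| |].
    rewrite E addr_nat -[Tb]addn0.
    by rewrite !upd_low ?TbT; [reflexivity|lia..].
  apply: reach_done; split=> // j lt_j /=.
  case: j lt_j => [|[|j]] lt_j; [by look|by look|].
  by rewrite !upd_other // done_T // lt_j.
rewrite (_ : d.+2 + d.+2 + 2 = (d.+1 + d.+1 + 2).+2)%N; last by lia.
have [N1 N2] := @ram_tail_nth d.+2 le_d.
eapply reach_load; [exact: N1|look|by rewrite addr_nat TbT; reflexivity|].
eapply reach_sub; [exact: N2|by rewrite upd_other; [look|]|by rewrite upd_other; [look|]|].
rewrite (_ : (132 - (d.+2 + d.+2)).+2 = 132 - (d.+1 + d.+1))%N; last by lia.
apply: IH.
- by lia.
- by rewrite upd_same addnS -natr1 addrK.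
- by rewrite !upd_other.
- move=> j lt_j hj; rewrite upd_other; last by apply/eqP; lia.
  have [->|ne] := eqVneq j d.+2; first exact: upd_same.
  by rewrite upd_other // done_T //; lia.
- by move=> j; rewrite !upd_low //; lia.
Qed.

Hypothesis mm0 : (0 < mm)%N.

Lemma ram_correct :
  exists2 s', run p ((3 * size dat + 200) * n.+1) (init_state k pts) = Some s' &
  exists g, [/\ (0 < g)%N, (k <= g * g * mm)%N,
    (g.-1 * g.-1 * mm < k)%N \/ g = 1%N &
    (forall i : 'I_n, in_unit (pts i)) -> forall j, (j < k)%N ->
    (exists2 i : 'I_n, (15 <= i)%N & hit G mm g tab (pts i) j) ->
    exists2 i : 'I_n, hit G mm g tab (pts i) j & s'.2 j = i%:R].
Proof.
pose Q (s : state R) := step p s = None /\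
  exists g, [/\ (0 < g)%N, (k <= g * g * mm)%N,
    (g.-1 * g.-1 * mm < k)%N \/ g = 1%N &
    (forall i : 'I_n, in_unit (pts i)) -> forall j, (j < k)%N ->
    (exists2 i : 'I_n, (15 <= i)%N & hit G mm g tab (pts i) j) ->
    exists2 i : 'I_n, hit G mm g tab (pts i) j & s.2 j = i%:R].
suff r : reach p ((3 * size dat + 200) * n.+1) (init_state k pts) Q.
  have [|s' run_s' [_ gP]] := reach_run r; first by move=> s' [].
  by exists s'.
(* The costs of setup, grid search, point loop and copying; the tail adds 3 + 64. *)
pose c1 := ((3 * size dat + 1) + 10).+4.+3.
pose c2 := (5 * k + 4)%N.
pose c3 := (40 * n + 2).+2%N.
pose c4 := (6 * k + 2).+2%N.
apply: (@reach_le _ _ (c1 + (c2 + (c3 + (c4 + 67))))).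
  by rewrite /c1 /c2 /c3 /c4; move: le_kn; clear; nia.
apply: reach_seq; first exact: (ram_setup (K := K) (G := G) pts entry_lt).
move=> [pc m] /= [-> Bm m8 Fm].
apply: reach_seq.
  by apply: (ram_grid (c := k) entry_lt mm0 _ (ltn0Sn 0) _ Bm m8 Fm); [lia | right].
move=> {Bm m8 Fm m pc} [pc m] /= [-> Bm Fm [g [g0 m8 le_k gP]]].
have [h0 h1 h2 h3 [h9 h10 h11 h12]] := Bm.
apply: (@reach_seq _ _ _ _ _ (fun s => [/\ s.1 = 58%N, ram_base K G dat n k s.2 & table_ok g n s.2])).
  do 2 exec1; apply: (ram_loop g0 (c := n) (i := 15)).
  - by lia.
  - by [].
  - split.
    + by split; [look..|split; look].
    + by apply: ram_frame_eq Fm => a lt_a; rewrite !upd_low //; lia.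
    + by look.
    + by look.
    + by look.
  - by move=> inU j lt_j [i' hi']; lia.
move=> {Bm h0 h1 h2 h3 h9 h10 h11 h12 m8 Fm m pc} [pc m] /= [-> Bm Tm].
have [h0 h1 h2 h3 [h9 h10 h11 h12]] := Bm.
pose T j := m (Tb + j)%N.
have T32 : (32 <= Tb)%N by rewrite /Tb /D; lia.
apply: (@reach_seq _ _ _ _ _ (fun s => [/\ s.1 = 67%N, s.2 12%N = Tb%:R,
      forall j, (32 <= j < k)%N -> s.2 j = T j &
      forall j, s.2 (Tb + j)%N = T j])).
  do 2 exec1; apply: (@ram_copy k 32 _ T); try look; try by lia.
    by rewrite upd_same [RHS]natrD.
  by move=> j; rewrite !upd_low //; lia.
move=> {Bm h0 h1 h2 h3 h9 h10 h11 h12} [pc' m'] /= [-> h12 hlow hhigh].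
do 3 exec1; apply: (@reach_seq _ _ 64 0 _ (fun s => step p s = None /\ forall j, (j < k)%N -> s.2 j = T j)).
  apply: (ram_tail_loop (d := 31)) => //.
  - by rewrite upd_other // upd_same [RHS]natrD.
  - move=> j lt_j /orP[lt_jk|]; last by lia.
    by rewrite !upd_low // hlow //; lia.
  - by move=> j; rewrite !upd_low //; lia.
move=> s' [st sT]; apply: reach_done; split=> //.
exists g; split=> // inU j lt_j [i le_i hj].
have [|i' [_ hi'] Ti'] := Tm inU j lt_j; first by exists i => //; rewrite le_i /=.
by exists i' => //; rewrite sT.
Qed.

End Correct.

(** * Packings and tilings *)

Section Geometry.
Variable R : realType.
Implicit Types (p q : R * R) (d e w : R).

Lemma edist_ge0 p q : 0 <= edist p q.
Proof. exact: sqrtr_ge0. Qed.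

Lemma edist_sqr p q : edist p q ^+ 2 = (p.1 - q.1) ^+ 2 + (p.2 - q.2) ^+ 2.
Proof. by rewrite sqr_sqrtr // addr_ge0 // sqr_ge0. Qed.

Lemma edist_triangle q p r : edist p r <= edist p q + edist q r.
Proof.
have h1 := edist_sqr p r; have h2 := edist_sqr p q; have h3 := edist_sqr q r.
have g1 := edist_ge0 p r; have g2 := edist_ge0 p q; have g3 := edist_ge0 q r.
move: (edist p r) (edist p q) (edist q r) h1 h2 h3 g1 g2 g3 => x y z h1 h2 h3 x0 y0 z0.
have yz : 0 <= y * z by rewrite mulr_ge0.
pose a := p.1 - q.1; pose b := p.2 - q.2; pose c := q.1 - r.1; pose d := q.2 - r.2.
have cs : a * c + b * d <= y * z.
  apply: le_trans (ler_norm _) _.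
  rewrite -(@ler_pXn2r _ 2) ?nnegrE // real_normK ?num_real //.
  rewrite exprMn h2 h3 -/a -/b -/c -/d.
  (* Cauchy-Schwarz by Lagrange's identity. *)
  by have := sqr_ge0 (a * d - b * c); nra.
rewrite -(@ler_pXn2r _ 2) ?nnegrE ?addr_ge0 // h1.
have -> : p.1 - r.1 = a + c by rewrite /a /c; ring.
have -> : p.2 - r.2 = b + d by rewrite /b /d; ring.
by rewrite [leRHS]sqrrD h2 h3 -/a -/b -/c -/d; nra.
Qed.

Definition near w p q := `|p.1 - q.1| <= w /\ `|p.2 - q.2| <= w.

Lemma nearC w p q : near w p q -> near w q p.
Proof. by case=> h1 h2; split; rewrite distrC. Qed.

Lemma near_trans w w' p q r : near w p q -> near w' q r -> near (w + w') p r.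
Proof.
move=> [h1 h2] [h3 h4]; split; apply: le_trans (ler_distD _ _ _) (lerD _ _).
- exact: h1.
- exact: h3.
- exact: h2.
- exact: h4.
Qed.

(* 3 / 2 stands for an upper bound of sqrt 2. *)
Lemma edist_near w p q : near w p q -> edist p q <= 3 / 2 * w.
Proof.
move=> [h1 h2]; have w0 : 0 <= w by apply: le_trans h1.
rewrite -(@ler_pXn2r _ 2) ?nnegrE ?edist_ge0 ?mulr_ge0 // edist_sqr.
have k1 : (p.1 - q.1) ^+ 2 <= w ^+ 2.
  by rewrite -(real_normK (num_real (p.1 - q.1))) ler_pXn2r ?nnegrE.
have k2 : (p.2 - q.2) ^+ 2 <= w ^+ 2.
  by rewrite -(real_normK (num_real (p.2 - q.2))) ler_pXn2r ?nnegrE.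
by have := sqr_ge0 w; nra.
Qed.

Lemma norm1_edist p q : `|p.1 - q.1| <= edist p q.
Proof.
rewrite -(@ler_pXn2r _ 2) ?nnegrE ?edist_ge0 // edist_sqr real_normK ?num_real //.
by rewrite lerDl sqr_ge0.
Qed.

Lemma norm2_edist p q : `|p.2 - q.2| <= edist p q.
Proof.
rewrite -(@ler_pXn2r _ 2) ?nnegrE ?edist_ge0 // edist_sqr real_normK ?num_real //.
by rewrite lerDr sqr_ge0.
Qed.

Definition unit_square p := (0 <= p.1 <= 1) && (0 <= p.2 <= 1).

(* [packable m d]: [m] points of the closed unit square at mutual distance at least [d]. *)
Definition packable (m : nat) d := 0 < d /\
  exists2 q : nat -> R * R, forall v, (v < m)%N -> unit_square (q v) &
    forall u v, (u < m)%N -> (v < m)%N -> u != v -> d <= edist (q u) (q v).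

Lemma packable_le m m' d : (m <= m')%N -> packable m' d -> packable m d.
Proof.
move=> le_m [d0 [q h1 h2]]; split=> //; exists q => [v lt_v|u v lt_u lt_v].
  by apply: h1; lia.
by apply: h2; lia.
Qed.

Lemma truncn_eq_dist (x y : R) : 0 <= x -> 0 <= y ->
  Num.truncn x = Num.truncn y -> `|x - y| <= 1.
Proof.
move=> /truncn_itv/andP[h1 h2] /truncn_itv/andP[h3 h4] E.
move: h1 h2; rewrite E -natr1 => h1 h2; move: h4; rewrite -natr1 => h4.
by rewrite ler_norml; apply/andP; split; lra.
Qed.

(** Pigeonhole on cells of side [1 / a], of which there are [a.+1] per side since a coordinate equal
    to 1 has index [a]. *)
Lemma packable_ub (m a : nat) d : packable m d -> (0 < a)%N ->
  (a.+1 * a.+1 < m)%N -> d * a%:R <= 3 / 2.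
Proof.
move=> [d0 [q h1 h2]] a0 lt_am.
have a0' : 0 < a%:R :> R by rewrite ltr0n.
have cl x : 0 <= x <= 1 -> (Num.truncn (x * a%:R : R) < a.+1)%N.
  move=> /andP[x0 x1]; rewrite truncn_lt_nat ?mulr_ge0 //.
  by rewrite -natr1; nra.
pose f (v : 'I_m) : 'I_a.+1 * 'I_a.+1 :=
  (inord (Num.truncn ((q v).1 * a%:R)), inord (Num.truncn ((q v).2 * a%:R))).
have : ~ injective f.
  move=> /leq_card; rewrite card_prod !card_ord; lia.
move=> /injectiveP/injectivePn[u [v ne]] [E1 E2].
have /andP[u1 u2] := h1 u (ltn_ord u); have /andP[v1 v2] := h1 v (ltn_ord v).
have {}E1 : Num.truncn ((q u).1 * a%:R) = Num.truncn ((q v).1 * a%:R).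
  by move/(congr1 val): E1; rewrite /= !inordK ?cl.
have {}E2 : Num.truncn ((q u).2 * a%:R) = Num.truncn ((q v).2 * a%:R).
  by move/(congr1 val): E2; rewrite /= !inordK ?cl.
case/andP: u1 u2 v1 v2 => u1 _ /andP[u2 _] /andP[v1 _] /andP[v2 _].
have nr : near a%:R^-1 (q u) (q v).
  have E (x y : R) : `|x - y| * a%:R = `|x * a%:R - y * a%:R|.
    by rewrite -mulrBl normrM (ger0_norm (ltW a0')).
  split; rewrite -[leRHS]mul1r ler_pdivlMr // E.
    by apply: truncn_eq_dist; rewrite ?mulr_ge0 ?(ltW a0').
  by apply: truncn_eq_dist; rewrite ?mulr_ge0 ?(ltW a0').
have := le_trans (h2 _ _ (ltn_ord u) (ltn_ord v) ne) (edist_near nr).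
by rewrite ler_pdivlMr.
Qed.

Lemma packable_grid (a : nat) : (0 < a)%N -> packable (a * a) (a%:R^-1).
Proof.
move=> a0; have a0' : 0 < a%:R :> R by rewrite ltr0n.
split; first by rewrite invr_gt0.
exists (fun v => ((v %/ a)%:R / a%:R, (v %% a)%:R / a%:R)).
  move=> v lt_v; rewrite /unit_square /= !divr_ge0 //= !ler_pdivrMr // !mul1r !ler_nat.
  have h1 : (v %/ a < a)%N by rewrite ltn_divLR.
  have h2 : (v %% a < a)%N by rewrite ltn_pmod.
  by rewrite (ltnW h1) (ltnW h2).
have far (x y : nat) : x != y -> a%:R^-1 <= `|x%:R / a%:R - y%:R / a%:R : R|.
  move=> ne; rewrite -mulrBl normrM (ger0_norm (_ : 0 <= a%:R^-1)) ?invr_ge0 ?(ltW a0') //.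
  rewrite ler_peMl ?invr_ge0 ?(ltW a0') //.
  have [lt_xy|lt_yx|//] := ltngtP x y; last by rewrite eq_sym in ne; move: ne; lia.
  - by rewrite distrC ger0_norm ?subr_ge0 ?ler_nat ?(ltnW lt_xy) // -natrB ?(ltnW lt_xy) // ler1n; lia.
  - by rewrite ger0_norm ?subr_ge0 ?ler_nat ?(ltnW lt_yx) // -natrB ?(ltnW lt_yx) // ler1n; lia.
move=> u v lt_u lt_v ne.
have [eq_d|ne_d] := eqVneq (u %/ a)%N (v %/ a)%N; last first.
  exact: le_trans (far _ _ ne_d) (norm1_edist (_, _) (_, _)).
have ne_m : (u %% a != v %% a)%N.
  by apply: contra_neq ne => E; rewrite (divn_eq u a) (divn_eq v a) eq_d E.
exact: le_trans (far _ _ ne_m) (norm2_edist (_, _) (_, _)).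
Qed.

End Geometry.

(** * Tables for a configuration and the tiling they define *)

Section Tables.
Variable R : realType.
Implicit Types (p : R * R) (q : nat -> R * R) (e w : R).

(** The inner radius [w1] makes slots easy to hit; the outer radius [w2] bounds how far a recognised
    point strays from its site. *)
Definition table_spec (G m : nat) q w1 w2 (tab : nat -> nat) :=
  (forall p v, in_unit p -> (v < m)%N -> near w1 p (q v) ->
     tab (cell G p) = v.+1) /\
  (forall p v, in_unit p -> tab (cell G p) = v.+1 ->
     (v < m)%N /\ near w2 p (q v)).

Lemma cell_near (G : nat) p p' : (0 < G)%N -> in_unit p -> in_unit p' ->
  cell G p = cell G p' -> near (G%:R^-1) p p'.
Proof.
move=> G0 /andP[x y] /andP[x' y'].
have G0' : 0 < G%:R :> R by rewrite ltr0n.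
have lt_y := tile_lt G0 y; have lt_y' := tile_lt G0 y'.
move: lt_y lt_y'; rewrite /cell /tile.
set a := Num.truncn (p.1 * _); set b := Num.truncn (p.2 * _).
set a' := Num.truncn (p'.1 * _); set b' := Num.truncn (p'.2 * _).
move=> lt_b lt_b' E.
have E2 : b = b'.
  by have := congr1 (modn^~ G) E; rewrite !modnMDl !modn_small.
have E1 : a = a'.
  by have := congr1 (divn^~ G) E; rewrite !divnMDl // !divn_small // !addn0.
have S (u v : R) : `|u - v| * G%:R = `|u * G%:R - v * G%:R|.
  by rewrite -mulrBl normrM (ger0_norm (ltW G0')).
case/andP: x y x' y' => x _ /andP[y _] /andP[x' _] /andP[y' _].
split; rewrite -[leRHS]mul1r ler_pdivlMr // S;
  by apply: truncn_eq_dist => //; rewrite mulr_ge0 // ltW.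
Qed.

(** A cell is labelled by a site within [w1] of some point of the cell, hence within [w2] of all of
    them. A competing site would be at distance at most [3 / 2 * (w1 + w2) <= 3 * w2 < e]. *)
Lemma table_exists (G m : nat) q e w1 w2 : (0 < G)%N -> w1 + G%:R^-1 <= w2 ->
  3 * w2 < e ->
  (forall u v, (u < m)%N -> (v < m)%N -> u != v -> e <= edist (q u) (q v)) ->
  exists tab, table_spec G m q w1 w2 tab.
Proof.
move=> G0 le_w lt_e far.
pose C (c v : nat) := (v < m)%N /\
  exists p, [/\ in_unit p, cell G p = c & near w1 p (q v)].
have /choice[tab tabP] : forall c, exists t,
    (forall v, C c v -> exists2 v', C c v' & t = v'.+1) /\
    (forall v, t = v.+1 -> C c v).
  move=> c.
  have [[v Cv]|nC] := pselect (exists v, C c v).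
    exists v.+1; split=> [_ _|v' [<-]//]; by exists v.
  by exists 0%N; split=> // v Cv; case: nC; exists v.
have mono w w' p p' : w <= w' -> near w p p' -> near w' p p'.
  by move=> le_ww' [h1 h2]; split; apply: le_trans le_ww'.
have nr p v : in_unit p -> C (cell G p) v -> near w2 p (q v).
  move=> Up [lt_v [p' [Up' E N]]].
  apply: mono le_w _; rewrite addrC; apply: near_trans N.
  exact: cell_near.
exists tab; split=> [p v Up lt_v N|p v Up].
  have [v' Cv' ->] := (tabP (cell G p)).1 v (conj lt_v (ex_intro _ p (And3 Up erefl N))).
  have [-> //|ne] := eqVneq v' v; exfalso.
  have N' := near_trans (nearC (nr _ _ Up Cv')) N.
  have := le_trans (far _ _ Cv'.1 lt_v ne) (edist_near N').
  have : 0 <= G%:R^-1 :> R by rewrite invr_ge0.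
  by move: le_w lt_e; lra.
by move=> /(tabP _).2 Cv; split; [exact: Cv.1 | exact: nr].
Qed.

Section Tiling.
Variables (G m g : nat) (q : nat -> R * R) (e w1 w2 : R) (tab : nat -> nat).
Hypotheses (m0 : (0 < m)%N) (g0 : (0 < g)%N) (le_w1 : 2 * w1 < e).
Hypothesis tabP : table_spec G m q w1 w2 tab.
(** The sites fill a square of side [1 - e], which leaves a gap [e] to the copies in adjacent tiles;
    the offset [w1] keeps the windows around sites inside the tile. *)
Hypothesis site_itv : forall v, (v < m)%N ->
  w1 <= (q v).1 <= 1 - e + w1 /\ w1 <= (q v).2 <= 1 - e + w1.
Hypothesis site_far : forall u v, (u < m)%N -> (v < m)%N -> u != v ->
  e <= edist (q u) (q v).

Let g0' : 0 < g%:R :> R. Proof. by rewrite ltr0n. Qed.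

Lemma tile_local (t : nat) (x y : R) : w1 <= y <= 1 - e + w1 ->
  (t%:R + y - w1) / g%:R <= x <= (t%:R + y - w1) / g%:R + 2 * w1 / g%:R ->
  [/\ 0 <= x, tile g x = t & `|local g x - y| <= w1].
Proof.
move=> /andP[y1 y2]; rewrite -mulrDl ler_pdivrMr // ler_pdivlMr // => /andP[x1 x2].
have tx : tile g x = t.
  apply: truncn_def; rewrite -natr1; apply/andP; split; move: le_w1; lra.
split=> //.
  by rewrite -(pmulr_lge0 _ g0') mulrC; have := ler0n R t; move: y1 x1; lra.
by rewrite /local tx ler_norml; apply/andP; split; lra.
Qed.

Lemma window_itv (t : nat) (y : R) : (t < g)%N -> w1 <= y <= 1 - e + w1 ->
  0 <= (t%:R + y - w1) / g%:R /\
  (t%:R + y - w1) / g%:R + 2 * w1 / g%:R < 1.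
Proof.
move=> lt_t /andP[y1 y2]; split.
  by rewrite divr_ge0 // -addrA addr_ge0 // subr_ge0.
rewrite -mulrDl ltr_pdivrMr // mul1r.
by move: lt_t; rewrite -(ler_nat R) -natr1; move: le_w1; lra.
Qed.

Lemma hit_window (j : nat) : (j < g * g * m)%N ->
  exists a b : R, [/\ 0 <= a /\ a + 2 * w1 / g%:R < 1, 0 <= b /\ b + 2 * w1 / g%:R < 1 &
    forall p, a <= p.1 <= a + 2 * w1 / g%:R -> b <= p.2 <= b + 2 * w1 / g%:R ->
      hit G m g tab p j].
Proof.
move=> lt_j.
pose v := (j %% m)%N; pose tx := (j %/ m %/ g)%N; pose ty := (j %/ m %% g)%N.
have lt_v : (v < m)%N by rewrite ltn_pmod.
have lt_tx : (tx < g)%N by rewrite /tx ltn_divLR // ltn_divLR.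
have lt_ty : (ty < g)%N by rewrite ltn_pmod.
have [s1 s2] := site_itv lt_v.
exists ((tx%:R + (q v).1 - w1) / g%:R), ((ty%:R + (q v).2 - w1) / g%:R).
split; [exact: window_itv|exact: window_itv|move=> p px py].
have [x0 Ex Nx] := tile_local s1 px; have [y0 Ey Ny] := tile_local s2 py.
have tabE : tab (cell G (local g p.1, local g p.2)) = v.+1.
  by apply: tabP.1 => //; apply/andP; split; apply: local_itv.
rewrite /hit tabE; split=> //.
by rewrite Ex Ey -divn_eq addnS -divn_eq.
Qed.

(** After scaling by [g], the points are within [w2] of copies [S], [S'] of sites. These are [e]
    apart, by the gap in different tiles and by [site_far] in the same tile. Each move costs at most
    [3 / 2 * w2]. *)
Lemma hit_far p p' (j j' : nat) : in_unit p -> in_unit p' ->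
  hit G m g tab p j -> hit G m g tab p' j' -> j != j' ->
  (e - 3 * w2) / g%:R <= edist p p'.
Proof.
move=> /andP[/andP[x0 x1] /andP[y0 y1]] /andP[/andP[x0' x1'] /andP[y0' y1']].
rewrite /hit; set c := cell G _; set c' := cell G _.
case E : (tab c) => [|v] [] // _ jE; case E' : (tab c') => [|v'] [] // _ jE' ne.
have [lt_v N] : (v < m)%N /\ near w2 (local g p.1, local g p.2) (q v).
  by apply: tabP.2 E; apply/andP; split; apply: local_itv.
have [lt_v' N'] : (v' < m)%N /\ near w2 (local g p'.1, local g p'.2) (q v').
  by apply: tabP.2 E'; apply/andP; split; apply: local_itv.
have [/andP[s1 s2] /andP[s3 s4]] := site_itv lt_v.
have [/andP[r1 r2] /andP[r3 r4]] := site_itv lt_v'.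
pose S := ((tile g p.1)%:R + (q v).1, (tile g p.2)%:R + (q v).2).
pose S' := ((tile g p'.1)%:R + (q v').1, (tile g p'.2)%:R + (q v').2).
pose P := (p.1 * g%:R, p.2 * g%:R); pose P' := (p'.1 * g%:R, p'.2 * g%:R).
have NS : near w2 S P.
  by case: N => n1 n2; split; rewrite distrC /= opprD addrA.
have NS' : near w2 P' S'.
  by case: N' => n1 n2; split; rewrite /= opprD addrA.
have PE : edist P P' = edist p p' * g%:R.
  rewrite /edist /= -!mulrBl !exprMn -mulrDl sqrtrM ?addr_ge0 ?sqr_ge0 //.
  by rewrite sqrtr_sqr ger0_norm // ltW.
have shift (a b : nat) (x y : R) : a != b -> 0 <= x - w1 <= 1 - e ->
    0 <= y - w1 <= 1 - e -> e <= `|(a%:R + x) - (b%:R + y)|.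
  move=> ne_ab /andP[h1 h2] /andP[h3 h4].
  have [lt_ab|lt_ba|eq_ab] := ltngtP a b; last by rewrite eq_ab eqxx in ne_ab.
  - rewrite distrC ler_normr; apply/orP; left.
    by move: lt_ab; rewrite -(ler_nat R) -natr1; lra.
  - rewrite ler_normr; apply/orP; left.
    by move: lt_ba; rewrite -(ler_nat R) -natr1; lra.
have far : e <= edist S S'.
  have [eq1|ne1] := eqVneq (tile g p.1) (tile g p'.1); last first.
    by apply: le_trans (norm1_edist S S'); apply: shift => //; apply/andP; split; lra.
  have [eq2|ne2] := eqVneq (tile g p.2) (tile g p'.2); last first.
    by apply: le_trans (norm2_edist S S'); apply: shift => //; apply/andP; split; lra.
  have ne_v : v != v'.
    by apply: contra_neq ne => eq_v; apply: succn_inj; rewrite jE jE' eq1 eq2 eq_v.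
  apply: le_trans (site_far lt_v lt_v' ne_v) _.
  have cancel (a x y : R) : a + x - (a + y) = x - y by ring.
  by rewrite /S /S' eq1 eq2 /Defs.edist /= !cancel.
have := edist_near NS; have := edist_near NS'.
have := edist_triangle P S S'; have := edist_triangle P' P S'.
rewrite ler_pdivrMr // -PE; move: far.
move: (edist S S') (edist S P) (edist P S') (edist P P') (edist P' S').
move=> d1 d2 d3 d4 d5 h1 h2 h3 h4 h5; lra.
Qed.

End Tiling.
End Tables.

(** * Packing density and almost optimal configurations *)

Section Density.
Variable R : realType.
Implicit Types (p : R * R) (d e w : R).

(** [packable_ub] with [a] the integer part of [s - 2]: then [a.+1 <= s - 1 < s] and [a > s - 3]. *)
Lemma packable_sqrt (k : nat) d : packable k d -> 4 <= Num.sqrt (k%:R : R) ->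
  d * (Num.sqrt (k%:R : R) - 3) <= 3 / 2.
Proof.
set s := Num.sqrt _ => pk s4.
have s2 : s ^+ 2 = k%:R by rewrite sqr_sqrtr.
have /truncn_itv/andP[h1 h2] : 0 <= s - 2 by lra.
set a := Num.truncn _ in h1 h2; rewrite -natr1 in h2.
have a0 : (0 < a)%N by rewrite -(ltr_nat R); lra.
have lt_a : (a.+1 * a.+1 < k)%N.
  by rewrite -(ltr_nat R) natrM -s2 -natr1; nra.
apply: le_trans (packable_ub pk a0 lt_a).
by rewrite ler_pM2l ?pk.1 //; lra.
Qed.

Definition shrink d := d / (1 + d).

Lemma shrinkE d : 0 < d -> shrink d * (1 + d) = d.
Proof. by move=> d0; rewrite /shrink divfK //; apply/eqP; lra. Qed.

Lemma shrink_gt0 d : 0 < d -> 0 < shrink d < 1.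
Proof. by move=> d0; have := shrinkE d0; nra. Qed.

Lemma shrink_le d : 0 < d -> shrink d <= d.
Proof. by move=> d0; have := shrinkE d0; have := shrink_gt0 d0; nra. Qed.

(** If [s >= 4] then [s <= 4 * (s - 3)], and [packable_sqrt] gives [4 * (3 / 2) = 6]; otherwise
    [shrink d < 1] suffices. *)
Lemma density_ub (m : nat) d : packable m d ->
  Num.sqrt (m%:R : R) * shrink d <= 6.
Proof.
move=> pk; have d0 := pk.1.
have /andP[e0 e1] := shrink_gt0 d0.
have s0 : 0 <= Num.sqrt (m%:R : R) by apply: sqrtr_ge0.
have [s4|s4] := lerP 4 (Num.sqrt (m%:R : R)); last by nra.
have := packable_sqrt pk s4; have := shrink_le d0.
by move: (Num.sqrt (m%:R : R)) s4 s0 => s s4 s0 h1 h2; nra.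
Qed.

Lemma optimal_tile : exists (lam : R) (m : nat) d,
  [/\ (0 < m)%N, packable m d, 999 / 10 ^+ 3 * lam <= Num.sqrt (m%:R : R) * shrink d,
      999 / 10 ^+ 3 <= lam &
      forall (k : nat) d', (0 < k)%N -> packable k d' ->
        Num.sqrt (k%:R : R) * shrink d' <= lam].
Proof.
pose E : set R := [set x | exists (m : nat) (d : R),
   [/\ (0 < m)%N, packable m d & x = Num.sqrt (m%:R : R) * shrink d]].
have ubE : has_ubound E by exists 6 => _ [m [d [_ pk ->]]]; apply: density_ub.
(* The 1000 by 1000 grid has value [1000 / 1001], which bounds [lam] from below. *)
have [a aE] : exists a : nat, a%:R = 10 ^+ 3 :> R by exists (10 ^ 3)%N; rewrite natrX.
have a0 : (0 < a)%N by rewrite -(ltr_nat R) aE; lra.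
have E1 : E (a%:R * shrink (a%:R^-1)).
  exists (a * a)%N, (a%:R^-1); split=> //.
  - by rewrite muln_gt0 a0.
  - exact: packable_grid.
  - by rewrite natrM -expr2 sqrtr_sqr ger0_norm.
have supE : has_sup E by split=> //; exists (a%:R * shrink (a%:R^-1)).
have lam1 : 999 / 10 ^+ 3 <= sup E.
  apply: le_trans (ub_le_sup ubE E1).
  have := @shrinkE (a%:R^-1) _; rewrite invr_gt0 ltr0n => /(_ a0).
  by rewrite aE; move: (shrink _) => z; lra.
have eps0 : 0 < 1 / 10 ^+ 3 * sup E by lra.
have [_ [m [d [m0 pk ->]]] lt_s] := sup_adherent eps0 supE.
exists (sup E), m, d; split=> //; first by lra.
by move=> k d' k0 pk'; apply: ub_le_sup => //; exists k, d'.
Qed.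

(** Closeness to the supremum replaces a compactness argument for an attained optimum. *)
Lemma optimal_packing (k : nat) : 4 <= Num.sqrt (k%:R : R) ->
  exists2 d : R, packable k d & forall d', packable k d' -> (1 - 1 / 10 ^+ 4) * d' <= d.
Proof.
move=> s4; have k0 : (0 < k)%N.
  by case: k s4 => //; rewrite sqrtr0; lra.
pose E : set R := [set d | packable k d].
have ubE : has_ubound E.
  exists 2 => d pk; have := packable_sqrt pk s4; have := pk.1.
  by move: (Num.sqrt (k%:R : R)) s4 => s s4 d0 h; nra.
have E1 : E (k%:R^-1).
  by apply: packable_le (packable_grid R k0); rewrite leq_pmulr.
have supE : has_sup E by split=> //; exists (k%:R^-1).
have sup0 : 0 < sup E.
  by apply: lt_le_trans (ub_le_sup ubE E1); rewrite invr_gt0 ltr0n.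
have eps0 : 0 < 1 / 10 ^+ 4 * sup E by lra.
have [d pk lt_s] := sup_adherent eps0 supE.
exists d => // d' pk'; have := ub_le_sup ubE pk'.
by lra.
Qed.

(** Scaling by [1 / (1 + d)] gives a square of side [1 - shrink d], so the margin equals the new
    mutual distance [shrink d]. *)
Lemma shrunk_sites (m : nat) d w : packable m d ->
  exists q : nat -> R * R,
    (forall v, (v < m)%N -> w <= (q v).1 <= 1 - shrink d + w /\
                            w <= (q v).2 <= 1 - shrink d + w) /\
    (forall u v, (u < m)%N -> (v < m)%N -> u != v -> shrink d <= edist (q u) (q v)).
Proof.
move=> [d0 [q q1 q2]]; have c0 : 0 < 1 + d by lra.
have E : 1 - shrink d = (1 + d)^-1.
  by rewrite /shrink; field; apply/eqP; lra.
exists (fun v => ((q v).1 / (1 + d) + w, (q v).2 / (1 + d) + w)); split=> [v lt_v|u v lt_u lt_v ne] /=.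
  have /andP[/andP[x0 x1] /andP[y0 y1]] := q1 v lt_v.
  rewrite !lerDr !lerD2r !divr_ge0 ?(ltW c0) //= E.
  by rewrite !ler_piMl ?invr_ge0 ?(ltW c0).
have -> : edist ((q u).1 / (1 + d) + w, (q u).2 / (1 + d) + w)
   ((q v).1 / (1 + d) + w, (q v).2 / (1 + d) + w) = edist (q u) (q v) / (1 + d).
  have cancel (x y : R) : x / (1 + d) + w - (y / (1 + d) + w) = (x - y) / (1 + d).
    by field; apply/eqP; lra.
  rewrite /Defs.edist /= !cancel !exprMn -mulrDl sqrtrM ?addr_ge0 ?sqr_ge0 //.
  by rewrite sqrtr_sqr ger0_norm // invr_ge0 ltW.
by rewrite /shrink ler_pM2r ?invr_gt0 //; exact: q2.
Qed.

(** [ln n = 2 * ln (sqrt n) <= 2 * sqrt n], and [4 <= c * sqrt n] once [n >= 16 / c ^ 2]. *)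
Lemma ln_le_linear (c : R) : 0 < c ->
  exists N : nat, forall n : nat, (N <= n)%N -> 2 * ln (n%:R : R) <= c * n%:R.
Proof.
move=> c0; exists (Num.truncn (16 / c ^+ 2)).+1 => n le_n.
have lt_n : 16 / c ^+ 2 < n%:R.
  by apply: lt_le_trans (truncnS_gt _) _; rewrite ler_nat.
have cc : 0 < c ^+ 2 by rewrite exprn_gt0.
rewrite ltr_pdivrMr // in lt_n.
have n0 : 0 < n%:R :> R.
  by rewrite ltr0n; apply: leq_trans le_n.
pose s := Num.sqrt (n%:R : R).
have s0 : 0 < s by rewrite sqrtr_gt0.
have s2 : s ^+ 2 = n%:R by rewrite sqr_sqrtr // ltW.
have h : ln s <= s.
  have := @le_ln1Dx R (s - 1).
  by rewrite (_ : 1 + (s - 1) = s); [move=> /(_ _) h; lra | ring].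
have -> : ln (n%:R : R) = ln s + ln s by rewrite -s2 expr2 lnM.
rewrite -s2; rewrite -s2 in lt_n.
have : 4 <= c * s.
  by rewrite -(@ler_pXn2r _ 2) ?nnegrE ?mulr_ge0 ?ltW // exprMn; lra.
by nra.
Qed.

End Density.

(** * Choice of the configurations *)

Section Adequate.
Variable R : realType.
Implicit Types (p : R * R) (d e w l L : R).

Definition has_windows (k : nat) (P : R * R -> nat -> Prop) l :=
  forall j, (j < k)%N -> exists a b : R,
    [/\ 0 <= a /\ a + l < 1, 0 <= b /\ b + l < 1 &
      forall p, a <= p.1 <= a + l -> b <= p.2 <= b + l -> P p j].

Definition separated (P : R * R -> nat -> Prop) L :=
  forall p p' j j', in_unit p -> in_unit p' -> P p j -> P p' j' -> j != j' ->
    L <= edist p p'.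

(** All that is asked of a table, for the [g] the search returns: windows of side [l], each
    expecting at least [2 * ln n] points, and a separation [L] beating 0.99 times every packing of
    [k] points. *)
Definition adequate (k n G m : nat) (tab : nat -> nat) :=
  forall g, (0 < g)%N -> (k <= g * g * m)%N ->
    (g.-1 * g.-1 * m < k)%N \/ g = 1%N ->
  exists l L, [/\ 0 < l <= 1 / 10, has_windows k (hit G m g tab) l,
    separated (hit G m g tab) L,
    0 < L /\ forall d, packable k d -> 99 / 100 * d < L &
    2 * ln (n%:R : R) <= l ^+ 2 * n%:R].

(** Each [k] gets [k] sites in a single tile. The window side depends on [K] alone, so a large [n]
    makes the windows big enough. *)
Lemma adequate_small (K : nat) : (0 < K)%N -> exists N : nat,
  forall G, (0 < G)%N -> G%:R^-1 <= K%:R^-1 / (2 * 10 ^+ 5) :> R ->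
  forall k, 3 * 10 ^+ 5 <= k%:R :> R -> (k <= K)%N ->
  exists tab, forall n, (N <= n)%N -> adequate k n G k tab.
Proof.
move=> K0; pose t : R := K%:R^-1; pose w2 := t / 10 ^+ 5; pose w1 := w2 / 2.
have t0 : 0 < t by rewrite invr_gt0 ltr0n.
have t1 : t <= 1 by rewrite invf_le1 ?ltr0n // ler1n.
have w20 : 0 < w2 ^+ 2 by rewrite exprn_gt0 // /w2; lra.
have [N NP] := ln_le_linear w20; exists N => G G0 le_G k le_k le_kK.
have k0 : (0 < k)%N by rewrite -(ltr_nat R); lra.
set s := Num.sqrt (k%:R : R).
have s0 : 0 <= s by exact: sqrtr_ge0.
have s2 : s ^+ 2 = k%:R by rewrite sqr_sqrtr.
(* Here [k >= 3 * 10 ^ 5] enters: it yields [d <= (3 / 2) / 544], so the factor [1 + d] lost by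
   shrinking fits into one percent. *)
have s547 : 547 <= s by rewrite leNgt; apply/negP => lt_s; nra.
have s4 : 4 <= s by lra.
have [d pk dopt] := optimal_packing s4.
have d0 := pk.1; have dub := packable_sqrt pk s4; rewrite -/s in dub.
have dlb := dopt _ (packable_le (leq_pmulr k k0) (packable_grid R k0)).
have tk : t <= k%:R^-1 by rewrite lef_pV2 ?posrE ?ltr0n // ler_nat.
have e_d := shrinkE d0; have /andP[e0 e1] := shrink_gt0 d0.
have d28 : d <= 28 / 10 ^+ 4 by nra.
have d_le : d <= shrink d * (1 + 28 / 10 ^+ 4) by nra.
have e_t : 99 / 100 * t <= shrink d by lra.
have [q [q1 q2]] := @shrunk_sites _ k d w1 pk.
have le_w : w1 + G%:R^-1 <= w2 by rewrite /w1 /w2 /t; move: le_G t0; rewrite /t; lra.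
have lt_w : 3 * w2 < shrink d by rewrite /w2; move: e_t t0; clear; lra.
have [tab tabP] := table_exists G0 le_w lt_w q2.
exists tab => n le_n g g0 le_g gP.
have g1 : g = 1%N.
  case: gP => //; apply: contraTeq => ne; rewrite -leqNgt leq_pmull //.
  by rewrite muln_gt0 andbb; case: (g) g0 ne => [|[|g']].
have w2_gt0 : 0 < w2 by rewrite /w2; move: t0; clear; lra.
have lt_w1 : 2 * w1 < shrink d by rewrite /w1; move: lt_w w2_gt0; clear; lra.
exists (2 * w1 / g%:R), ((shrink d - 3 * w2) / g%:R); split.
- by rewrite g1 divr1 /w1 /w2; move: t0 t1; clear; lra.
- move=> j lt_j; apply: (hit_window _ g0 lt_w1 tabP q1) => //.
  exact: leq_trans le_g.
- move=> p p' j j' Up Up' h h' ne.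
  exact: (hit_far g0 tabP q1 q2 Up Up' h h' ne).
- rewrite g1 divr1; split; first by move: lt_w; clear; lra.
  by move=> d' /dopt h; rewrite /w2; move: h d_le e_t t0; clear; lra.
- by rewrite g1 divr1 (_ : 2 * w1 = w2); [exact: NP | rewrite /w1; field].
Qed.

(** One near-optimal tile serves every large [k]: [lam] bounds all packings of [k] points, and
    rounding up to [g * g] tiles loses little when [k] is large compared with [m]. *)
Lemma adequate_large : exists (K m : nat) (r : R), [/\ (0 < m)%N, 0 < r &
  forall G, (0 < G)%N -> G%:R^-1 <= r -> exists tab,
  forall k n : nat, (K <= k)%N -> 0 < ln (n%:R : R) ->
    10 ^+ 5 * ln (n%:R : R) * k%:R <= n%:R -> adequate k n G m tab].
Proof.
have [lam [m [d [m0 pk lam_le lam1 lamP]]]] := optimal_tile R.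
pose sg := Num.sqrt (m%:R : R); rewrite -/sg in lam_le.
have sg2 : sg ^+ 2 = m%:R by rewrite sqr_sqrtr.
have sg0 : 0 < sg by rewrite sqrtr_gt0 ltr0n.
pose t := sg^-1; have t0 : 0 < t by rewrite invr_gt0.
have sgt : sg * t = 1 by rewrite mulfV // gt_eqF.
have m1 : 1 <= m%:R :> R by rewrite ler1n.
have sg1 : 1 <= sg by rewrite leNgt; apply/negP => lt_s; nra.
have t1 : t <= 1 by nra.
(* The squared side (2 w1 / g)^2 of a window must be at least 2 ln n / n, which the
   hypothesis on k gives once 4 * 10^5 * (w1 / t)^2 > 2; moving two points by w2 costs
   3 * w2 = 0.678 percent of t, and shrink d is almost at least t. *)
pose w1 := 225 / 10 ^+ 5 * t; pose w2 := 113 / (5 * 10 ^+ 4) * t.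
have d0 := pk.1; have /andP[e0 e1] := shrink_gt0 d0.
(* The two summands ensure [s >= 10 ^ 4] and [s >= 10 ^ 3 * sg] for [s = sqrt k]. *)
exists (Num.truncn (10 ^+ 8 + 10 ^+ 6 * m%:R : R)).+1, m, (t / 10 ^+ 5).
split=> //; first by rewrite divr_gt0.
move=> G G0 le_G.
have e_t : 998 / 10 ^+ 3 * t <= shrink d.
  have -> : shrink d = sg * shrink d * t by rewrite mulrAC sgt mul1r.
  by rewrite ler_pM2r //; move: lam_le lam1; clear; lra.
have [q [q1 q2]] := @shrunk_sites _ m d w1 pk.
have le_w : w1 + G%:R^-1 <= w2 by rewrite /w1 /w2; move: le_G; clear; lra.
have lt_w : 3 * w2 < shrink d by rewrite /w2; move: e_t t0; clear; lra.
have [tab tabP] := table_exists G0 le_w lt_w q2.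
exists tab => k n le_k ln0 le_n g g0 le_g gP.
have {}le_k : 10 ^+ 8 + 10 ^+ 6 * m%:R <= k%:R :> R.
  by apply: le_trans (ltW (truncnS_gt _)) _; rewrite ler_nat.
have k0 : (0 < k)%N.
  by rewrite -(ltr_nat R); have := ler0n R m; move: le_k; clear; lra.
pose s := Num.sqrt (k%:R : R).
have s2 : s ^+ 2 = k%:R by rewrite sqr_sqrtr.
have s0 : 0 <= s by exact: sqrtr_ge0.
have s4 : 10 ^+ 4 <= s.
  by rewrite leNgt; apply/negP => lt_s; move: le_k s2 s0 m1 lt_s; clear; nra.
have s_sg : 10 ^+ 3 * sg <= s.
  by rewrite leNgt; apply/negP => lt_s; move: le_k s2 s0 sg2 sg0 lt_s; clear; nra.
have g0' : 0 < g%:R :> R by rewrite ltr0n.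
(* Minimality of [g] gives [(g - 1) * sg < s], and [sg] is at most a thousandth of [s]. *)
have gs : g%:R * sg <= (1 + 1 / 10 ^+ 3) * s.
  case: gP => [lt_g|->]; last by rewrite mul1r; move: s_sg s0; clear; lra.
  have : g.-1%:R * sg < s.
    rewrite -(@ltr_pXn2r _ 2) ?nnegrE ?mulr_ge0 ?(ltW sg0) // s2 exprMn sg2.
    by rewrite -natrX -natrM ltr_nat -mulnn.
  by rewrite -{2}(prednK g0) -natr1 mulrDl mul1r; move: s_sg s0; clear; lra.
have lt_w1 : 2 * w1 < shrink d by rewrite /w1; move: e_t t0; clear; lra.
exists (2 * w1 / g%:R), ((shrink d - 3 * w2) / g%:R); split.
- apply/andP; split; first by rewrite divr_gt0 // /w1; move: t0; clear; lra.
  rewrite ler_pdivrMr //; have : 1 <= g%:R :> R by rewrite ler1n.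
  by rewrite /w1; move: t1; clear; lra.
- move=> j lt_j; apply: (hit_window _ g0 lt_w1 tabP q1) => //.
  exact: leq_trans le_g.
- move=> p p' j j' Up Up' h h' ne.
  exact: (hit_far g0 tabP q1 q2 Up Up' h h' ne).
- have L0 : 0 < shrink d - 3 * w2 by move: lt_w; clear; lra.
  split; first by rewrite divr_gt0.
  move=> d' pk'; have d'0 := pk'.1.
  have ub := packable_sqrt pk'; rewrite -/s in ub; have {}ub := ub _.
  have {}ub : d' * (s - 3) <= 3 / 2 by apply: ub; move: s4; clear; lra.
  have d'le : d' <= 2 / 10 ^+ 4 by move: ub s4 d'0; clear; nra.
  have lamd := lamP _ _ k0 pk'; rewrite -/s in lamd.
  have ed' := shrinkE d'0; have /andP[e'0 _] := shrink_gt0 d'0.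
  have d'e : d' <= shrink d' * (1 + 2 / 10 ^+ 4).
    by move: ed' d'le e'0; clear; nra.
  have sd' : s * d' <= (1 + 2 / 10 ^+ 4) * lam by move: d'e lamd s0; clear; nra.
  (* Times [g * sg], the claim follows from [0.99 * 1.001 * 1.0002 * lam < 0.999 * lam - 0.00678],
     which holds as [lam >= 0.999]. *)
  rewrite ltr_pdivlMr // -(ltr_pM2r sg0).
  have -> : 99 / 100 * d' * g%:R * sg = 99 / 100 * (d' * (g%:R * sg)) by ring.
  have -> : (shrink d - 3 * w2) * sg = sg * shrink d - 339 / (5 * 10 ^+ 4) * (sg * t).
    by rewrite /w2; field.
  have : d' * (g%:R * sg) <= (1 + 1 / 10 ^+ 3) * (s * d') by move: gs d'0; clear; nra.
  by rewrite sgt; move: sd' lam_le lam1; clear; lra.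
- pose l := 2 * w1 / g%:R; rewrite -/l.
  have lE : l * (g%:R * sg) = 45 / 10 ^+ 4.
    rewrite /l mulrA divfK ?gt_eqF // /w1.
    have -> : 2 * (225 / 10 ^+ 5 * t) * sg = 45 / 10 ^+ 4 * (sg * t) by field.
    by rewrite sgt mulr1.
  have l0 : 0 < l by rewrite /l divr_gt0 // /w1; move: t0; clear; lra.
  have ls : 449 / 10 ^+ 5 <= l * s by move: lE gs l0; clear; nra.
  have ls2 : 2 / 10 ^+ 5 <= l ^+ 2 * s ^+ 2 by rewrite -exprMn; move: ls; clear; nra.
  have l20 : 0 < l ^+ 2 by rewrite exprn_gt0.
  apply: le_trans (ler_wpM2l (ltW l20) le_n); rewrite -s2.
  have -> : l ^+ 2 * (10 ^+ 5 * ln (n%:R : R) * s ^+ 2) =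
     10 ^+ 5 * ln (n%:R : R) * (l ^+ 2 * s ^+ 2) by ring.
  by move: ls2 ln0; clear; nra.
Qed.

End Adequate.

(** * Probability that every slot is hit *)

Section Uniform.
Variable R : realType.
Local Notation leb := (@lebesgue_measure R).

Lemma lebesgue_sub_itv (a l : R) : 0 <= a -> 0 <= l -> a + l <= 1 ->
  leb (`[a, a + l] `&` `[0, 1]) = l%:E.
Proof.
move=> a0 l0 al; have -> : `[a, a + l] `&` `[0, 1] = `[a, a + l]%classic :> set R.
  apply/seteqP; split=> x /=; rewrite !in_itv /=; [by case | case/andP=> h1 h2].
  by rewrite h1 h2; split=> //; apply/andP; split; lra.
rewrite lebesgue_measure_itv /= lte_fin; case: ltP => h; rewrite ?EFinN -?EFinD.
  by congr (_%:E); ring.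
by congr (_%:E); lra.
Qed.

Context {d : measure_display} {T : measurableType d} (P : probability T R).

Lemma uniform01_itv (X : T -> R) (a l : R) : uniform01 P X ->
  0 <= a -> 0 <= l -> a + l <= 1 -> P (X @^-1` `[a, a + l]) = l%:E.
Proof.
by move=> U a0 l0 al; rewrite U ?lebesgue_sub_itv //; exact: measurable_itv.
Qed.

Lemma uniform01_itvC (X : T -> R) (a l : R) : measurable_fun setT X ->
  uniform01 P X -> 0 <= a -> 0 <= l -> a + l <= 1 ->
  P (X @^-1` (~` `[a, a + l])) = (1 - l)%:E.
Proof.
move=> mX U a0 l0 al; rewrite preimage_setC probability_setC.
  by rewrite uniform01_itv // EFinB.
by have := mX measurableT _ (measurable_itv (Interval (BLeft a) (BRight (a + l)))); rewrite setTI.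
Qed.

Lemma uniform01_out (X : T -> R) : uniform01 P X ->
  P (X @^-1` (~` `[0, 1[)) = 0%E.
Proof.
move=> U; rewrite U; last by apply: measurableC; exact: measurable_itv.
rewrite (_ : _ `&` _ = [set 1]) ?lebesgue_measure_set1 //.
apply/seteqP; split=> x /=; rewrite !in_itv /=.
  move=> [/negP h1 /andP[h2 h3]]; rewrite h2 /= -leNgt in h1; lra.
move=> ->; rewrite lexx ler01 ltxx andbF; split=> //.
Qed.

Lemma measure_bigsetU_sum (I : Type) (s : seq I) (A : I -> set T) :
  (forall i, measurable (A i)) ->
  (P (\big[setU/set0]_(i <- s) A i) <= \sum_(i <- s) P (A i))%E.
Proof.
move=> mA; elim: s => [|i s IH]; first by rewrite !big_nil measure0.
rewrite !big_cons; apply: le_trans (measureU2 _ _ _) _ => //.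
  exact: bigsetU_measurable.
by rewrite leeD2l.
Qed.

Section Samples.
Variables (n : nat) (X Y : 'I_n -> T -> R).
Hypothesis indep : mutually_independent P
  (fun ib : 'I_n * bool => if ib.2 then X ib.1 else Y ib.1).
Hypotheses (unifX : forall i, uniform01 P (X i)) (unifY : forall i, uniform01 P (Y i)).

Let mX i : measurable_fun setT (X i).
Proof. exact: (indep.1 (i, true)). Qed.

Let mY i : measurable_fun setT (Y i).
Proof. exact: (indep.1 (i, false)). Qed.

Let mpre (Z : T -> R) (B : set R) : measurable_fun setT Z -> measurable B ->
  measurable (Z @^-1` B).
Proof. by move=> mZ mB; have := mZ measurableT _ mB; rewrite setTI. Qed.

Lemma rectangles_prob (BX BY : 'I_n -> set R) (x y : 'I_n -> R) :
  (forall i, measurable (BX i)) -> (forall i, measurable (BY i)) ->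
  (forall i, P (X i @^-1` BX i) = (x i)%:E) ->
  (forall i, P (Y i @^-1` BY i) = (y i)%:E) ->
  measurable [set w | forall i, BX i (X i w) /\ BY i (Y i w)] /\
  P [set w | forall i, BX i (X i w) /\ BY i (Y i w)] = (\prod_(i < n) (x i * y i))%:E.
Proof.
move=> mBX mBY Px Py.
pose B (ib : 'I_n * bool) := if ib.2 then BX ib.1 else BY ib.1.
pose F (ib : 'I_n * bool) := if ib.2 then X ib.1 else Y ib.1.
have E : [set w | forall i, BX i (X i w) /\ BY i (Y i w)] =
    \bigcap_(ib in [set: 'I_n * bool]) (F ib @^-1` B ib).
  apply/seteqP; split=> w /=.
    by move=> h [i []] _; have [] := h i.
  by move=> h i; split; [exact: (h (i, true)) | exact: (h (i, false))].
have mB ib : measurable (B ib).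
  by case: ib => i []; rewrite /B /=; [exact: mBX | exact: mBY].
split; rewrite E.
  apply: fin_bigcap_measurable => [|ib _]; first exact: finite_finset.
  by apply: mpre => //; exact: (indep.1 ib).
rewrite (indep.2 B mB) -prodEFin.
rewrite -(pair_bigA _ (fun i b => P (F (i, b) @^-1` B (i, b)))) /=.
by apply: eq_bigr => i _; rewrite big_bool /= Px Py EFinM.
Qed.

(** Missing a square is not a product event in the two coordinates, so it is split: [X] misses, or
    [X] hits and [Y] misses. A function [c] records the case for each point, and each [c] gives a
    product event. *)
Lemma miss_prob (a b l : R) : 0 <= a -> 0 <= b -> 0 < l -> a + l < 1 -> b + l < 1 ->
  let bad := [set w | forall i : 'I_n, (15 <= i)%N ->
    ~ (a <= X i w <= a + l /\ b <= Y i w <= b + l)] in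
  measurable bad /\ (P bad <= ((1 - l ^+ 2) ^+ (n - 15))%:E)%E.
Proof.
move=> a0 b0 l0 al bl bad.
(* The ignored points get one full case and one empty case, so that they contribute the factor 1. *)
pose BX (i : nat) (c : bool) : set R := if (i < 15)%N then (if c then setT else set0)
  else if c then ~` `[a, a + l] else `[a, a + l]%classic.
pose BY (i : nat) (c : bool) : set R := if (i < 15)%N then setT
  else if c then setT else ~` `[b, b + l].
pose x (i : nat) (c : bool) : R := if (i < 15)%N then c%:R else if c then 1 - l else l.
pose y (i : nat) (c : bool) : R := if (i < 15)%N then 1 else if c then 1 else 1 - l.
have mBX i c : measurable (BX i c).
  rewrite /BX; case: ifP => _; case: c.
  - exact: measurableT.
  - exact: measurable0.
  - by apply: measurableC; exact: measurable_itv.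
  - exact: measurable_itv.
have mBY i c : measurable (BY i c).
  rewrite /BY; case: ifP => _; case: c => //.
  by apply: measurableC; exact: measurable_itv.
have Px (i : 'I_n) c : P (X i @^-1` BX i c) = (x i c)%:E.
  rewrite /BX /x; case: ifP => _; case: c.
  - by rewrite preimage_setT probability_setT.
  - by rewrite preimage_set0 measure0.
  - by rewrite uniform01_itvC // ltW.
  - by rewrite uniform01_itv // ltW.
have Py (i : 'I_n) c : P (Y i @^-1` BY i c) = (y i c)%:E.
  rewrite /BY /y; case: ifP => _; case: c.
  - by rewrite preimage_setT probability_setT.
  - by rewrite preimage_setT probability_setT.
  - by rewrite preimage_setT probability_setT.
  - by rewrite uniform01_itvC // ltW.
pose E (c : {ffun 'I_n -> bool}) :=
  [set w | forall i : 'I_n, BX i (c i) (X i w) /\ BY i (c i) (Y i w)].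
have EP c := rectangles_prob (fun i => mBX i (c i)) (fun i => mBY i (c i))
  (fun i => Px i (c i)) (fun i => Py i (c i)).
have mbad : bad = \big[setU/set0]_(c : {ffun 'I_n -> bool}) E c.
  rewrite -bigcup_seq; apply/seteqP; split=> w /=.
    move=> h; exists [ffun i : 'I_n => (i < 15)%N || ~~ (a <= X i w <= a + l)] => //=.
      by rewrite mem_index_enum.
    move=> i; rewrite ffunE /BX /BY.
    have [//|le_i] := ltnP i 15; have {}h := h i le_i.
    case: (boolP (a <= X i w <= a + l)) => hX /=; rewrite !in_itv /=; last first.
      by split=> //; apply/negP.
    by split=> // hY; apply: h.
  move=> [c _ Ec] i le_i; have := Ec i; rewrite /BX /BY ltnNge le_i /=.
  by case: (c i) => /= -[]; rewrite !in_itv /= => h1 h2 [].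
split.
  by rewrite mbad; apply: bigsetU_measurable => c _; exact: (EP c).1.
rewrite mbad; apply: le_trans (measure_bigsetU_sum _ _) _ => [c|].
  exact: (EP c).1.
under eq_bigr do rewrite (EP _).2.
(* The sum over all [c] factors, with [(1 - l) + l * (1 - l) = 1 - l ^ 2] for each point that
   counts. *)
rewrite sumEFin lee_fin -(bigA_distr_bigA (fun (i : 'I_n) c => x i c * y i c)).
under eq_bigr do rewrite big_bool.
rewrite le_eqVlt; apply/orP; left; apply/eqP.
pose f (i : nat) := x i true * y i true + x i false * y i false.
rewrite -(big_mkord xpredT f).
have fE i : f i = if (i < 15)%N then 1 else 1 - l ^+ 2.
  by rewrite /f /x /y; case: ifP => _ /=; ring.
elim: (n) => [|m IH]; first by rewrite big_geq // expr0.
rewrite big_nat_recr //= IH fE; case: ltnP => h.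
  have /eqP-> : (m - 15 == 0)%N by rewrite subn_eq0 ltnW.
  by have /eqP-> : (m.+1 - 15 == 0)%N; rewrite ?subn_eq0 ?mulr1.
by rewrite subSn // [RHS]exprSr.
Qed.

End Samples.
End Uniform.

Section Coverage.
Context {R : realType} {d : measure_display} {T : measurableType d} (P : probability T R).
Variables (n : nat) (X Y : 'I_n -> T -> R).
Hypothesis indep : mutually_independent P
  (fun ib : 'I_n * bool => if ib.2 then X ib.1 else Y ib.1).
Hypotheses (unifX : forall i, uniform01 P (X i)) (unifY : forall i, uniform01 P (Y i)).

(** [A] excludes the null event of a coordinate outside [[0, 1)] and, by a union bound, the [k]
    events of a missed window. *)
Lemma coverage_prob (k : nat) (a b : nat -> R) (l : R) : 0 < l ->
  (forall j, (j < k)%N -> [/\ 0 <= a j, a j + l < 1, 0 <= b j & b j + l < 1]) ->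
  exists A : set T, [/\ measurable A,
    forall w, A w -> (forall i, in_unit (X i w, Y i w)) /\
      forall j, (j < k)%N -> exists2 i : 'I_n, (15 <= i)%N &
        a j <= X i w <= a j + l /\ b j <= Y i w <= b j + l &
    ((1 - k%:R * (1 - l ^+ 2) ^+ (n - 15))%:E <= P A)%E].
Proof.
move=> l0 ab.
have mC (Z : T -> R) : measurable_fun setT Z -> measurable (Z @^-1` (~` `[0, 1[)).
  move=> mZ; have := mZ measurableT (~` `[0, 1[); rewrite setTI; apply.
  by apply: measurableC; exact: measurable_itv.
pose O (i : 'I_n) := X i @^-1` (~` `[0, 1[) `|` Y i @^-1` (~` `[0, 1[).
pose bad (j : 'I_k) := [set w | forall i : 'I_n, (15 <= i)%N ->
    ~ (a j <= X i w <= a j + l /\ b j <= Y i w <= b j + l)].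
have mO i : measurable (O i).
  by apply: measurableU; apply: mC; [exact: (indep.1 (i, true)) | exact: (indep.1 (i, false))].
have PO i : P (O i) = 0%E.
  have mXi := mC _ (indep.1 (i, true)); have mYi := mC _ (indep.1 (i, false)).
  apply/eqP; rewrite -measure_le0; apply: le_trans (measureU2 _ mXi mYi) _.
  have PX := uniform01_out (unifX i); have PY := uniform01_out (unifY i).
  by rewrite [X in (X + _)%E]PX [X in (_ + X)%E]PY adde0.
have badP (j : 'I_k) : measurable (bad j) /\ (P (bad j) <= ((1 - l ^+ 2) ^+ (n - 15))%:E)%E.
  by have [a0 al b0 bl] := ab j (ltn_ord j); exact: miss_prob.
pose B := \big[setU/set0]_(i <- enum 'I_n) O i `|` \big[setU/set0]_(j <- enum 'I_k) bad j.
have mB1 : measurable (\big[setU/set0]_(i <- enum 'I_n) O i).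
  exact: bigsetU_measurable.
have mB2 : measurable (\big[setU/set0]_(j <- enum 'I_k) bad j).
  by apply: bigsetU_measurable => j _; exact: (badP j).1.
have mB : measurable B by apply: measurableU.
exists (~` B); split; first exact: measurableC.
  move=> w nB; split=> [i|j lt_j].
    rewrite /in_unit /=.
    have nO : ~ O i w.
      move=> Ow; apply: nB; left; rewrite -bigcup_seq; exists i => //=.
      by rewrite mem_enum.
    have inX : `[0, 1[%classic (X i w) by apply: contrapT => h; apply: nO; left.
    have inY : `[0, 1[%classic (Y i w) by apply: contrapT => h; apply: nO; right.
    by move: inX inY; rewrite /= !in_itv /= => -> ->.
  have nbad : ~ bad (Ordinal lt_j) w.
    move=> Ow; apply: nB; right; rewrite -bigcup_seq; exists (Ordinal lt_j) => //=.
    by rewrite mem_enum.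
  apply: contrapT => h; apply: nbad => i le_i hi; apply: h; exists i => //.
rewrite probability_setC // EFinB; apply: leeB => //.
apply: le_trans (measureU2 _ _ _) _ => //.
rewrite -[leRHS]add0e; apply: leeD.
  by apply: le_trans (measure_bigsetU_sum _ _ mO) _; rewrite big1.
apply: le_trans (measure_bigsetU_sum _ _ (fun j => (badP j).1)) _.
apply: (@le_trans _ _ (\sum_(j <- enum 'I_k) ((1 - l ^+ 2) ^+ (n - 15))%:E)%E).
  by apply: lee_sum => j _; exact: (badP j).2.
by rewrite sumEFin big_const_seq count_predT size_enum_ord iter_addr addr0 mulr_natl.
Qed.

End Coverage.

(** * The failure probability, and bounds on the optimum and on the output *)

Section Final.
Variable R : realType.

(** [(1 - l ^ 2) ^ (n - 15) <= exp (15 * l ^ 2) / n ^ 2 <= 2 / n ^ 2], where [l <= 1 / 10] absorbs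
    the 15 ignored points; then [2 * k <= n]. *)
Lemma coverage_bound (n k : nat) (l : R) : (2 <= n)%N -> 0 < l <= 1 / 10 ->
  2 * ln (n%:R : R) <= l ^+ 2 * n%:R -> 2 * k%:R <= n%:R :> R ->
  k%:R * (1 - l ^+ 2) ^+ (n - 15) <= n%:R^-1.
Proof.
move=> n2 /andP[l0 l1] hl hk.
have n0 : 0 < n%:R :> R by rewrite ltr0n; lia.
have l20 : 0 <= l ^+ 2 by exact: sqr_ge0.
have l21 : l ^+ 2 <= 1 / 100 by nra.
have p1 : (1 - l ^+ 2) ^+ (n - 15) <= expR (- (l ^+ 2)) ^+ (n - 15).
  by rewrite lerXn2r ?nnegrE ?expR_ge0 //; [lra | exact: (expR_ge1Dx (- l ^+ 2))].
have p2 : expR (- (l ^+ 2)) ^+ (n - 15) <= expR (15 * l ^+ 2 - 2 * ln (n%:R : R)).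
  rewrite -expRM_natl ler_expR.
  have : n%:R - 15 <= (n - 15)%:R :> R.
    by rewrite lerBlDr -(natrD _ _ 15) ler_nat; lia.
  by nra.
have p3 : expR (15 * l ^+ 2 - 2 * ln (n%:R : R)) <= 2 * (n%:R^-1 * n%:R^-1).
  rewrite expRD; apply: ler_pM; rewrite ?expR_ge0 //.
    have : 1 + - (15 * l ^+ 2) <= expR (- (15 * l ^+ 2)) by exact: expR_ge1Dx.
    rewrite expRN => h.
    have e0 := expR_gt0 (15 * l ^+ 2).
    move: (expR (15 * l ^+ 2)) e0 h => z z0 h.
    have : (1 + - (15 * l ^+ 2)) * z <= 1.
      by apply: le_trans (ler_wpM2r (ltW z0) h) _; rewrite mulVf // gt_eqF.
    by nra.
  have -> : - (2 * ln (n%:R : R)) = - ln (n%:R : R) + - ln (n%:R : R) by ring.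
  by rewrite expRD !expRN lnK ?posrE.
apply: le_trans (ler_wpM2l (ler0n _ _) (le_trans p1 (le_trans p2 p3))) _.
have -> : k%:R * (2 * (n%:R^-1 * n%:R^-1)) = (2 * k%:R) * n%:R^-1 * n%:R^-1 :> R by ring.
rewrite ler_piMl ?invr_ge0 ?ler0n //.
by rewrite ler_pdivrMr // mul1r.
Qed.

(** A [k]-subset with larger minimum distance would itself be a packing at distance [M]. *)
Lemma dispersion_opt_le (n k : nat) (pts : 'I_n -> R * R) (M : R) : 0 < M ->
  (forall i, unit_square (pts i)) -> (forall d, packable k d -> d < M) ->
  (dispersion_opt k pts <= M%:E)%E.
Proof.
move=> M0 U H; rewrite /dispersion_opt; apply: bigmax_le; first exact: leNye.
move=> S /eqP cS; rewrite leNgt; apply/negP => lt_M.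
suff /H : packable k M by rewrite ltxx.
split=> //.
have sz : size (enum S) = k by rewrite -cardE.
case: (posnP k) => [k0|k0].
  by exists (fun=> (0, 0)) => [v|u v]; rewrite k0 // ltn0.
have [i0 _] : exists i0, i0 \in S by apply/set0Pn; rewrite -card_gt0 cS.
pose q v := nth i0 (enum S) v.
have qS v : (v < k)%N -> q v \in S by move=> lt_v; rewrite -mem_enum mem_nth ?sz.
exists (fun v => pts (q v)) => [v _|u v lt_u lt_v ne]; first exact: U.
have ne' : q v != q u.
  by rewrite nth_uniq ?sz ?enum_uniq // eq_sym.
rewrite -lee_fin; apply: le_trans (ltW lt_M) _.
rewrite /mindist; apply: le_trans (bigmin_le_cond _ _ (qS u lt_u)) _.
apply: (@bigmin_le_cond _ _ _ _ _ (fun j => (j \in S) && (j != q u))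
  (fun j => (edist (pts (q u)) (pts j))%:E)).
by rewrite qS.
Qed.

Lemma mindist_ge (n : nat) (pts : 'I_n -> R * R) (S : {set 'I_n}) (L : R) :
  (forall i j, i \in S -> j \in S -> i != j -> L <= edist (pts i) (pts j)) ->
  (L%:E <= mindist pts S)%E.
Proof.
move=> H; rewrite /mindist; apply: le_bigmin; first exact: leey.
move=> i iS; apply: le_bigmin; first exact: leey.
by move=> j /andP[jS ne]; rewrite lee_fin H // eq_sym.
Qed.

Lemma hit_ext (G m g : nat) (tab tab' : nat -> nat) (p : R * R) j : (0 < G)%N ->
  (forall c, (c < G * G)%N -> tab c = tab' c) -> in_unit p ->
  hit G m g tab p j -> hit G m g tab' p j.
Proof.
move=> G0 E /andP[/andP[x0 _] /andP[y0 _]]; rewrite /hit E //.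
by apply: cell_lt => //; apply/andP; split; apply: local_itv.
Qed.

Lemma hit_inj (G m g : nat) (tab : nat -> nat) (p : R * R) j j' :
  hit G m g tab p j -> hit G m g tab p j' -> j = j'.
Proof. by move=> [_ h] [_ h']; apply: succn_inj; rewrite h h'. Qed.

(** The conditions single out the least positive [g]. This identifies the [g] of a run on random
    points with the [g] for which the windows were fixed beforehand. *)
Lemma grid_unique (k m g g' : nat) : (0 < g)%N -> (0 < g')%N ->
  (k <= g * g * m)%N -> (k <= g' * g' * m)%N ->
  (g.-1 * g.-1 * m < k)%N \/ g = 1%N -> (g'.-1 * g'.-1 * m < k)%N \/ g' = 1%N ->
  g = g'.
Proof.
move=> g0 g'0 le_g le_g' gP g'P; apply/eqP; rewrite eqn_leq; apply/andP; split.
  case: gP => [lt_g|->//]; rewrite leqNgt; apply/negP => lt_gg.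
  have : (k <= g.-1 * g.-1 * m)%N.
    by apply: leq_trans le_g' _; rewrite leq_mul // leq_mul // -ltnS prednK.
  by rewrite leqNgt lt_g.
case: g'P => [lt_g|->//]; rewrite leqNgt; apply/negP => lt_gg.
have : (k <= g'.-1 * g'.-1 * m)%N.
  by apply: leq_trans le_g _; rewrite leq_mul // leq_mul // -ltnS prednK.
by rewrite leqNgt lt_g.
Qed.

End Final.

(** * Correctness of the output *)

Section Assembly.
Variable R : realType.

(** A point hits at most one slot, so distinct slots receive distinct points, and these are [L]
    apart while the optimum is at most [100 / 99 * L]. *)
Lemma good_output_hit (n k G m g : nat) (tab : nat -> nat) (pts : 'I_n -> R * R)
    (L : R) (s : nat -> R) :
  (forall i, in_unit (pts i)) -> separated (hit G m g tab) L ->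
  0 < L -> (forall d, packable k d -> 99 / 100 * d < L) ->
  (forall j, (j < k)%N -> exists2 i : 'I_n, hit G m g tab (pts i) j & s j = i%:R) ->
  good_output k pts s.
Proof.
move=> U sep L0 opt H.
have /choice[f fP] : forall j : 'I_k, exists i : 'I_n,
    hit G m g tab (pts i) j /\ s j = i%:R.
  by move=> j; have [i h1 h2] := H j (ltn_ord j); exists i.
have f_inj : injective f.
  move=> j j' E; apply: val_inj; have := (fP j).1; rewrite E => h.
  exact: hit_inj h (fP j').1.
exists f; split=> //; split=> [j|]; first exact: (fP j).2.
apply: (@le_trans _ _ L%:E).
  have -> : L%:E = ((99 / 100 : R)%:E * (100 / 99 * L)%:E)%E.
    by rewrite -EFinM; congr (_%:E); field.
  apply: lee_wpmul2l; first by rewrite lee_fin; lra.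
  apply: dispersion_opt_le => [|i|d /opt]; [lra| |lra].
  by have /andP[/andP[x0 x1] /andP[y0 y1]] := U i; rewrite /unit_square x0 y0 !ltW.
apply: mindist_ge => _ _ /imsetP[j _ ->] /imsetP[j' _ ->] ne.
apply: (sep _ _ j j' (U _) (U _) (fP j).1 (fP j').1).
by apply: contra_neq ne => /val_inj ->.
Qed.

Lemma adequate_table : exists (K G N : nat) (mt : nat -> nat * (nat -> nat)),
  [/\ (0 < G)%N, forall e, (0 < (mt e).1)%N &
  forall k n : nat, (N <= n)%N -> 3 * 10 ^+ 5 <= k%:R :> R ->
    0 < ln (n%:R : R) -> 10 ^+ 5 * ln (n%:R : R) * k%:R <= n%:R ->
    let e := minn k K in adequate R k n G (mt e).1 (mt e).2].
Proof.
have [K0 [m0 [r [m00 r0 large]]]] := adequate_large R.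
have [N small] := adequate_small R (ltn0Sn K0).
set K := K0.+1 in small *.
(* A resolution above [b] is fine enough for the large and the small configurations at once. *)
pose b : R := r^-1 + (K%:R^-1 / (2 * 10 ^+ 5))^-1.
have c0 : 0 < K%:R^-1 / (2 * 10 ^+ 5) :> R.
  by rewrite divr_gt0 ?invr_gt0 ?ltr0n //; lra.
have lt_b : b < (Num.truncn b).+1%:R by exact: truncnS_gt.
set G := (Num.truncn b).+1 in lt_b.
have Gle (c : R) : 0 < c -> c^-1 <= b -> G%:R^-1 <= c.
  move=> cp le_b; rewrite -[leRHS]invrK lef_pV2 ?posrE ?invr_gt0 ?ltr0n //.
  exact: le_trans le_b (ltW lt_b).
have G1 : G%:R^-1 <= r by apply: Gle => //; rewrite /b lerDl invr_ge0 ltW.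
have G2 : G%:R^-1 <= K%:R^-1 / (2 * 10 ^+ 5) :> R.
  by apply: Gle => //; rewrite /b lerDr invr_ge0 ltW.
have [tab0 tab0P] := large G (ltn0Sn _) G1.
have mtE : forall e, exists mt : nat * (nat -> nat), (0 < mt.1)%N /\
    if (e < K)%N then 3 * 10 ^+ 5 <= e%:R :> R ->
      forall n, (N <= n)%N -> adequate R e n G mt.1 mt.2
    else mt = (m0, tab0).
  move=> e; case lt_e : (e < K)%N; last by exists (m0, tab0).
  have [le_e|lt_e'] := lerP (3 * 10 ^+ 5) (e%:R : R); last first.
    (* A placeholder for [e < 3 * 10 ^ 5]; its positive site count keeps the grid search finite on
       such inputs. *)
    by exists (1%N, fun=> 0%N); split=> // h; move: lt_e'; lra.
  have [tab tabP] := small G (ltn0Sn _) G2 e le_e (ltnW lt_e).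
  exists (e, tab); split=> //=; rewrite -(ltr_nat R); lra.
have [mt mtP] := choice mtE.
exists K, G, N, mt; split=> // [e|k n le_n le_k ln0 le_kn]; first exact: (mtP e).1.
cbv zeta; have [lt_k|le_Kk] := ltnP k K.
  by have := (mtP k).2; rewrite lt_k => /(_ le_k n le_n).
have := (mtP K).2; rewrite ltnn => -> /=.
by apply: tab0P => //; exact: ltnW.
Qed.

End Assembly.

Theorem theorem4 (R : realType) :
  exists (prog : seq instr) (C : nat),
    (* O(n) running time: halts within C (n+1) steps on every input *)
    (forall (n k : nat) (pts : 'I_n -> R * R), (k <= n)%N ->
       exists s', run prog (C * n.+1) (init_state k pts) = Some s') /\
    (* for all sufficiently large n, w.p. >= 1 - 1/n, correct output *)
    (exists N : nat, forall n k : nat, (N <= n)%N ->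
       (3 * 10 ^ 5 <= k)%N ->
       (k%:R : R) <= n%:R / ((10 ^+ 5 : R) * ln (n%:R : R)) ->
       forall (d : measure_display) (T : measurableType d) (P : probability T R)
              (X Y : 'I_n -> T -> R),
         mutually_independent P
           (fun ib : 'I_n * bool => if ib.2 then X ib.1 else Y ib.1) ->
         (forall i, uniform01 P (X i)) -> (forall i, uniform01 P (Y i)) ->
         exists A : set T, measurable A /\
           A `<=` [set w | ram_solves prog k (fun i => (X i w, Y i w))] /\
           ((1 - (n%:R : R)^-1)%:E <= P A)%E).
Proof.
have [K [G [N0 [mt [G0 mt0 mtP]]]]] := adequate_table R.
pose S := (G * G).+1.
pose entry a := if (a %% S == 0)%N then (mt (a %/ S)%N).1
  else (mt (a %/ S)%N).2 (a %% S).-1.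
pose dat := mkseq entry (K.+1 * S).
have nth0 e : (e <= K)%N -> nth 0%N dat (e * S) = (mt e).1.
  move=> le_e; rewrite nth_mkseq ?ltn_pmul2r //.
  by rewrite /entry modnMl eqxx mulnK.
have nthS e c : (e <= K)%N -> (c < G * G)%N -> nth 0%N dat (e * S + c.+1) = (mt e).2 c.
  move=> le_e lt_c; have lt_cS : (c.+1 < S)%N by [].
  rewrite nth_mkseq; last first.
    by apply: (@leq_trans (e.+1 * S)); rewrite ?leq_pmul2r // mulSn addnC ltn_add2r.
  by rewrite /entry modnMDl modn_small //= divnMDl // divn_small // addn0.
have correct n k (pts : 'I_n -> R * R) : (k <= n)%N ->
  let e := minn k K in
  exists2 s', run (ram_prog K G dat) ((3 * size dat + 200) * n.+1) (init_state k pts)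
    = Some s' &
  exists g, [/\ (0 < g)%N, (k <= g * g * (mt e).1)%N,
    (g.-1 * g.-1 * (mt e).1 < k)%N \/ g = 1%N &
    (forall i : 'I_n, in_unit (pts i)) -> forall j, (j < k)%N ->
    (exists2 i : 'I_n, (15 <= i)%N & hit G (mt e).1 g (mt e).2 (pts i) j) ->
    exists2 i : 'I_n, hit G (mt e).1 g (mt e).2 (pts i) j & s'.2 j = i%:R].
  move=> le_kn e; have le_e : (e <= K)%N by exact: geq_minr.
  have entry_le : (e.+1 * S <= size dat)%N by rewrite size_mkseq leq_pmul2r.
  have := @ram_correct R K G dat G0 n k le_kn entry_le pts.
  rewrite -/e -/S nth0 // => /(_ (mt0 e))[s' run_s' [g [g0 le_g gP H]]].
  exists s' => //; exists g; split=> // inU j lt_j [i le_i hi].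
  have [|i' hi' si'] := H inU j lt_j.
    by exists i => //; apply: hit_ext hi => // c lt_c; rewrite nthS.
  by exists i' => //; apply: hit_ext hi' => // c lt_c; rewrite nthS.
exists (ram_prog K G dat), (3 * size dat + 200)%N; split.
  by move=> n k pts /(correct n k pts)[s' run_s' _]; exists s'.
exists (maxn N0 2) => n k; rewrite geq_max => /andP[le_n n2] le_k le_kn d T P X Y
  indep unifX unifY.
have n0 : 0 < n%:R :> R by rewrite ltr0n (leq_trans _ n2).
(* From [ln x <= x - 1] at [x = 1 / n]; it makes the divisor in the bound on [k] positive and yields
   [2 * k <= n]. *)
have ln2 : 1 / 2 <= ln (n%:R : R).
  have n2' : n%:R^-1 <= 2^-1 :> R by rewrite lef_pV2 ?posrE // ler_nat.
  have := @le_ln1Dx R (n%:R^-1 - 1).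
  have n0' : 0 < n%:R^-1 :> R by rewrite invr_gt0.
  by rewrite (_ : 1 + _ = n%:R^-1) ?lnV ?posrE // => [/(_ _) h|]; [lra|ring].
have le_k' : 3 * 10 ^+ 5 <= k%:R :> R.
  by rewrite -natrX -natrM ler_nat.
have {}le_kn : 10 ^+ 5 * ln (n%:R : R) * k%:R <= n%:R.
  by rewrite mulrC -ler_pdivlMr // mulr_gt0 //; lra.
have le_2k : 2 * k%:R <= n%:R :> R by nra.
have le_kn' : (k <= n)%N by rewrite -(ler_nat R); have := ler0n R k; lra.
have ln0 : 0 < ln (n%:R : R) by lra.
have adeq := mtP k n le_n le_k' ln0 le_kn; cbv zeta in adeq.
(* The tile count does not depend on the points, so it is read off a run on a dummy input. *)
have [_ _ [g [g0 le_g gP _]]] := correct n k (fun=> (0, 0)) le_kn'.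
have [l [L [l01 win sep [L0 opt] ll]]] := adeq g g0 le_g gP.
have winE : forall j, exists ab : R * R, (j < k)%N ->
    [/\ 0 <= ab.1 /\ ab.1 + l < 1, 0 <= ab.2 /\ ab.2 + l < 1 &
      forall p : R * R, ab.1 <= p.1 <= ab.1 + l -> ab.2 <= p.2 <= ab.2 + l ->
        hit G (mt (minn k K)).1 g (mt (minn k K)).2 p j].
  move=> j; case: (ltnP j k) => [lt_j|_]; last by exists (0, 0).
  by have [a [b h]] := win j lt_j; exists (a, b).
have [ab abP] := choice winE.
have /andP[l0 _] := l01.
have [|A [mA AP PA]] := @coverage_prob R d T P n X Y indep unifX unifY k
    (fun j => (ab j).1) (fun j => (ab j).2) l l0.
  by move=> j /abP[[? ?] [? ?] _].
exists A; split=> //; split; last first.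
  apply: le_trans PA; rewrite lee_fin lerD2l lerN2.
  exact: coverage_bound.
move=> w /AP[inU cov]; set pts := fun i => (X i w, Y i w).
have [s' run_s' [g' [g'0 le_g' g'P H]]] := correct n k pts le_kn'.
have eq_g := grid_unique g0 g'0 le_g le_g' gP g'P; rewrite -eq_g in H.
exists ((3 * size dat + 200) * n.+1)%N, s'; split=> //.
apply: (good_output_hit inU sep L0 opt) => j lt_j.
apply: H => //; have [i le_i [hx hy]] := cov j lt_j; exists i => //.
by have [_ _] := abP j lt_j; apply.
Qed.
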